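(* Let $\underline{\mathcal C}:\mathbf{Bij}^{op}\to\mathbf{Set}$ be a functor. The quotient of the set of commands of the $\mu$-syntax over $\underline{\mathcal C}$ by $=_\mu$ is in one-to-one correspondence with the set of unrooted trees over $\underline{\mathcal C}$ modulo $\alpha$-conversion; that is, for every finite set $X$ there exists a bijection $\Phi_X:\mu\mathtt{Comm}_{\underline{\mathcal C}}(X)/_{=_\mu}\to\mathtt T_{\underline{\mathcal C}}(X)$.
   Context: CONVENTIONS. Fix an infinite set $V$ of variables; ''finite set'' means finite subset of $V$, and $\mathbf{Bij}$ is the category of finite sets and bijections. For $a\in\underline{\mathcal C}(X)$ and a bijection $\sigma:X'\to X$, $a^\sigma=\underline{\mathcal C}(\sigma)(a)\in\underline{\mathcal C}(X')$. $\mu$-SYNTAX over $\underline{\mathcal C}$: commands $c::=\langle s\,|\,t\rangle\mid\underline a\{t_x\,|\,x\in X\}$ and terms $s,t::=x\mid\mu x.c$, where $x\in V$ and $a\in\underline{\mathcal C}(X)$ ($\underline a\{t_x|x\in X\}$ carries a family of terms indexed by $X$). Typing judgements $c:X$ (commands) and $X\,|\,s$ (terms), $X$ a finite set: $\{x\}\,|\,x$; if $a\in\underline{\mathcal C}(X)$ and $Y_x\,|\,t_x$ for $x\in X$ with the $Y_x$ pairwise disjoint, then $\underline a\{t_x|x\in X\}:\bigcup_{x}Y_x$; if $X\,|\,s$, $Y\,|\,t$ with $X\cap Y=\emptyset$, then $\langle s|t\rangle:X\cup Y$; if $c:X$ and $x\in X$, then $X\setminus\{x\}\,|\,\mu x.c$.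 $\mu\mathtt{Comm}_{\underline{\mathcal C}}(X)$ is the set of commands of type $X$. $\mu$ binds; $c[s/x]$ is capture-avoiding substitution of $s$ for the unique free occurrence of $x$. $=_\mu$ is the smallest (type-respecting) congruence generated by (MU1) $\langle s|t\rangle=\langle t|s\rangle$; (MU2) $\langle\mu x.c\,|\,s\rangle=c[s/x]$; (MU3) $\mu x.c=\mu y.c[y/x]$, $y$ fresh with respect to all variables of $c$ except $x$; (MU4) $\underline a\{t_x|x\in X\}=\underline{a^\sigma}\{t_{\sigma(y)}|y\in Y\}$ for every bijection $\sigma:Y\to X$. TREES over $\underline{\mathcal C}$. An ordinary corolla is a term $a(x_1,\dots,x_n)$ with $a\in\underline{\mathcal C}(X)$, $X=\{x_1,\dots,x_n\}$ (order of variables irrelevant); its set of free variables is $FV(a)=X$. A special corolla is a term $(x,y)=(y,x)$ with $x\ne y$ in $V$; $FV((x,y))=\{x,y\}$. A graph $\mathcal T=\{\text{corollas};\sigma\}$ is a non-empty finite set of corollas with mutually disjoint free variables, with an involution $\sigma$ on the set $V(\mathcal T)$ of all their variables. Its edges are the pairs $\{x,\sigma(x)\}$ with $\sigma(x)\neq x$ (joining the corollas containing $x$ and $\sigma(x)$); $FV(\mathcal T)$ is the set of fixpoints of $\sigma$. An unrooted tree is either an ordinary unrooted tree (a connected graph without loops, multiple edges and cycles all of whose corollas are ordinary) or an exceptional unrooted tree $\{(x,y);{\it id}_{\{x,y\}}\}$ (exactly one special corolla). Two unrooted trees are $\alpha$-equivalent if one is obtained from the other by renaming variables that are not fixpoints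 of the involution (to fresh distinct variables), replacing each ordinary corolla $a$ by $a^\tau$ with $\tau$ the corresponding renaming bijection (if $x$ is renamed to $z$, then $\tau(z)=x$), and transporting the involution. $\mathtt T_{\underline{\mathcal C}}(X)$ is the set of $\alpha$-classes of unrooted trees $\mathcal T$ with $FV(\mathcal T)=X$. *)

(* Defs.v *)
(* MathComp, with finmap and the classical layer of MathComp-Analysis. *)
From Stdlib Require Export Relation_Operators.
From mathcomp Require Export all_boot finmap.
From mathcomp Require Export boolp classical_sets functions cardinality.

Set Implicit Arguments.
Unset Strict Implicit.
Unset Printing Implicit Defensive.

Local Open Scope fset_scope.

(* The set of equivalence classes of [R] (an equivalence relation in all uses
   below). *)
Definition quotient (T : Type) (R : T -> T -> Prop) : Type :=
  {A : set T | exists x, A = [set y | R x y]%classic}.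

(** * Functors [Bij^op -> Set] *)

Record fbij (V : choiceType) (X Y : {fset V}) := FBij {
  fbij_fun :> X -> Y;
  fbij_bij : bijective fbij_fun }.

Definition fbij_id (V : choiceType) (X : {fset V}) : fbij X X :=
  FBij (@Bijective X X id id (fun=> erefl) (fun=> erefl)).

Definition fbij_comp (V : choiceType) (X Y Z : {fset V})
    (tau : fbij Y Z) (sigma : fbij X Y) : fbij X Z :=
  FBij (bij_comp (fbij_bij tau) (fbij_bij sigma)).

(* [act sigma a] is a^sigma. *)
Record bijFunctor (V : choiceType) := BijFunctor {
  obj :> {fset V} -> Type;
  act : forall X Y : {fset V}, fbij X Y -> obj Y -> obj X;
  act_id : forall (X : {fset V}) (a : obj X), act (fbij_id X) a = a;
  act_comp : forall (X Y Z : {fset V}) (sigma : fbij X Y) (tau : fbij Y Z)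
    (a : obj Z), act (fbij_comp tau sigma) a = act sigma (act tau a) }.

Section MuSyntax.
Context (V : choiceType) (C : bijFunctor V).

(* Raw syntax with named variables, not quotiented by renaming of bound
   variables: that renaming is one of the equations below.  In [Op X a t] the
   elements of [X] only index the family [t]; they are not occurrences of
   variables. *)
Inductive command : Type :=
| Cut (s t : term)
| Op (X : {fset V}) (a : C X) (t : X -> term)
with term : Type :=
| Var (x : V)
| Mu (x : V) (c : command).

Fixpoint fvC (c : command) : {fset V} :=
  match c with
  | Cut s t => fvT s `|` fvT t
  | Op X a t => \big[fsetU/fset0]_(x : X) fvT (t x)
  end
with fvT (s : term) : {fset V} :=
  match s with
  | Var x => [fset x]
  | Mu x c => fvC c `\ x
  end.

(* All variables, free, bound or binding. *)
Fixpoint varsC (c : command) : {fset V} :=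
  match c with
  | Cut s t => varsT s `|` varsT t
  | Op X a t => \big[fsetU/fset0]_(x : X) varsT (t x)
  end
with varsT (s : term) : {fset V} :=
  match s with
  | Var x => [fset x]
  | Mu x c => x |` varsC c
  end.

(* [x] itself if it is not in [A], and otherwise a chosen variable outside [A]
   (which exists as soon as [V] is infinite). *)
Definition avoid (x : V) (A : {fset V}) : V :=
  if x \in A then xget x [set z | z \notin A]%classic else x.

Definition upd (rho : V -> term) (x : V) (s : term) : V -> term :=
  fun y => if y == x then s else rho y.

(* Capture-avoiding simultaneous substitution: under a binder, the bound
   variable is replaced, if necessary, by one that is free in none of the terms
   substituted in its scope. *)
Fixpoint substC (rho : V -> term) (c : command) : command :=
  match c with
  | Cut s t => Cut (substT rho s) (substT rho t)
  | Op X a t => Op a (fun x => substT rho (t x))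
  end
with substT (rho : V -> term) (s : term) : term :=
  match s with
  | Var x => rho x
  | Mu x c =>
      let z := avoid x (\bigcup_(y <- fvC c `\ x) fvT (rho y)) in
      Mu z (substC (upd rho x (Var z)) c)
  end.

(* c[s/x] *)
Definition subst1 (c : command) (s : term) (x : V) : command :=
  substC (upd Var x s) c.

Inductive typC : {fset V} -> command -> Prop :=
| typ_cut (X Y : {fset V}) (s t : term) :
    typT X s -> typT Y t -> [disjoint X & Y] ->
    typC (X `|` Y) (Cut s t)
| typ_op (X : {fset V}) (a : C X) (t : X -> term) (Y : X -> {fset V}) :
    (forall x, typT (Y x) (t x)) ->
    (forall x y, x != y -> [disjoint Y x & Y y]) ->
    typC (\big[fsetU/fset0]_(x : X) Y x) (Op a t)
with typT : {fset V} -> term -> Prop :=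
| typ_var (x : V) : typT [fset x] (Var x)
| typ_mu (X : {fset V}) (x : V) (c : command) :
    typC X c -> x \in X -> typT (X `\ x) (Mu x c).

Inductive mu_axiomC : command -> command -> Prop :=
| MU1 (s t : term) : mu_axiomC (Cut s t) (Cut t s)
| MU2 (x : V) (c : command) (s : term) :
    mu_axiomC (Cut (Mu x c) s) (subst1 c s x)
| MU4 (X Y : {fset V}) (sigma : fbij Y X) (a : C X) (t : X -> term) :
    mu_axiomC (Op a t) (Op (act sigma a) (fun y => t (sigma y))).

Inductive mu_axiomT : term -> term -> Prop :=
| MU3 (x y : V) (c : command) :
    y \notin varsC c `\ x ->
    mu_axiomT (Mu x c) (Mu y (subst1 c (Var y) x)).

(* [mu_eqC X c d]: c and d are commands of type X and c =_mu d; similarly for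
   terms. *)
Inductive mu_eqC : {fset V} -> command -> command -> Prop :=
| mu_eqC_axiom (X : {fset V}) (c d : command) :
    typC X c -> typC X d -> mu_axiomC c d -> mu_eqC X c d
| mu_eqC_refl (X : {fset V}) (c : command) : typC X c -> mu_eqC X c c
| mu_eqC_sym (X : {fset V}) (c d : command) : mu_eqC X c d -> mu_eqC X d c
| mu_eqC_trans (X : {fset V}) (c d e : command) :
    mu_eqC X c d -> mu_eqC X d e -> mu_eqC X c e
| mu_eqC_cut (X Y : {fset V}) (s s' t t' : term) :
    mu_eqT X s s' -> mu_eqT Y t t' -> [disjoint X & Y] ->
    mu_eqC (X `|` Y) (Cut s t) (Cut s' t')
| mu_eqC_op (X : {fset V}) (a : C X) (t t' : X -> term) (Y : X -> {fset V}) :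
    (forall x, mu_eqT (Y x) (t x) (t' x)) ->
    (forall x y, x != y -> [disjoint Y x & Y y]) ->
    mu_eqC (\big[fsetU/fset0]_(x : X) Y x) (Op a t) (Op a t')
with mu_eqT : {fset V} -> term -> term -> Prop :=
| mu_eqT_axiom (X : {fset V}) (s t : term) :
    typT X s -> typT X t -> mu_axiomT s t -> mu_eqT X s t
| mu_eqT_refl (X : {fset V}) (s : term) : typT X s -> mu_eqT X s s
| mu_eqT_sym (X : {fset V}) (s t : term) : mu_eqT X s t -> mu_eqT X t s
| mu_eqT_trans (X : {fset V}) (s t u : term) :
    mu_eqT X s t -> mu_eqT X t u -> mu_eqT X s u
| mu_eqT_mu (X : {fset V}) (x : V) (c d : command) :
    mu_eqC X c d -> x \in X -> mu_eqT (X `\ x) (Mu x c) (Mu x d).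

Definition muComm (X : {fset V}) : Type := {c : command | typC X c}.

Definition mu_eq (X : {fset V}) (c d : muComm X) : Prop :=
  mu_eqC X (sval c) (sval d).

End MuSyntax.

Section Trees.
Context (V : choiceType) (C : bijFunctor V).

(* The special corolla (x,y) = (y,x), x <> y, is given by the unordered pair
   {x,y}. *)
Inductive corolla : Type :=
| Ordinary (X : {fset V}) (a : C X)
| Special (e : {fset V}) of #|` e| == 2.

Definition fv_cor (K : corolla) : {fset V} :=
  match K with
  | Ordinary X _ => X
  | Special e _ => e
  end.

Definition is_ordinary (K : corolla) : bool :=
  if K is Ordinary _ _ then true else false.

Definition vars_of (T : set corolla) : set V :=
  [set x | exists2 K, T K & x \in fv_cor K]%classic.

(* An involution on the set of variables of the graph is encoded as an
   involution of V that is the identity outside that set (it then maps the set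
   to itself). *)
Record graph := Graph {
  corollas : set corolla;
  inv : V -> V;
  corollas_nonempty : (corollas !=set0)%classic;
  corollas_finite : finite_set corollas;
  corollas_disjoint : forall K L, corollas K -> corollas L -> K <> L ->
    [disjoint fv_cor K & fv_cor L];
  inv_involutive : involutive inv;
  inv_outside : forall x, ~ vars_of corollas x -> inv x = x }.

Definition vars (T : graph) : set V := vars_of (corollas T).

Definition fv (T : graph) : set V :=
  [set x | vars T x /\ inv T x = x]%classic.

(* [e] is an edge of [T] and joins the corollas [K] and [L]. *)
Definition joins (T : graph) (e : {fset V}) (K L : corolla) : Prop :=
  [/\ corollas T K, corollas T L &
   exists x, [/\ x \in fv_cor K, inv T x \in fv_cor L, inv T x <> x &
              e = [fset x; inv T x]]].

Definition adjacent (T : graph) (K L : corolla) : Prop :=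
  exists e, joins T e K L.

Definition connected (T : graph) : Prop :=
  forall K L, corollas T K -> corollas T L ->
    clos_refl_trans corolla (adjacent T) K L.

Definition no_loops (T : graph) : Prop := forall e K, ~ joins T e K K.

Definition no_multiple_edges (T : graph) : Prop :=
  forall e e' K L, joins T e K L -> joins T e' K L -> e = e'.

(* [ordS i] is the cyclic successor of [i] in {0,...,n-1}; cycles of length
   1 and 2 are loops and multiple edges. *)
Definition no_cycles (T : graph) : Prop :=
  forall (n : nat) (K : 'I_n -> corolla), 2 < n -> injective K ->
    ~ (forall i, adjacent T (K i) (K (ordS i))).

Definition ordinary_tree (T : graph) : Prop :=
  [/\ forall K, corollas T K -> is_ordinary K,
      connected T, no_loops T, no_multiple_edges T & no_cycles T].

Definition exceptional_tree (T : graph) : Prop :=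
  (exists (e : {fset V}) (e2 : #|` e| == 2),
     corollas T = [set Special e2]%classic) /\
  (forall x, inv T x = x).

Definition unrooted_tree (T : graph) : Prop :=
  ordinary_tree T \/ exceptional_tree T.

(* [rename_cor f K L]: L is obtained from K by renaming each variable x to
   f x.  For K = a(x_1,...,x_n) this is a^tau, where tau sends f x to x. *)
Inductive rename_cor (f : V -> V) : corolla -> corolla -> Prop :=
| rename_ordinary (X Z : {fset V}) (a : C X) (tau : fbij Z X) :
    (forall z : Z, f (val (tau z)) = val z) ->
    rename_cor f (Ordinary a) (Ordinary (act tau a))
| rename_special (e e' : {fset V}) (e2 : #|` e| == 2) (e2' : #|` e'| == 2) :
    e' = [fset f x | x in e] ->
    rename_cor f (Special e2) (Special e2').

(* One renaming of variables that are not fixpoints of the involution to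
   distinct variables not occurring in [T]. *)
Definition renaming (T T' : graph) : Prop :=
  exists f : V -> V,
    [/\ forall x, fv T x -> f x = x,
        forall x, vars T x -> f x <> x -> ~ vars T (f x),
        forall x y, vars T x -> vars T y -> f x = f y -> x = y,
        corollas T' =
          [set L | exists2 K, corollas T K & rename_cor f K L]%classic &
        forall x, vars T x -> inv T' (f x) = f (inv T x)].

(* A single renaming to fresh variables is not transitive (it cannot exchange
   two variables), so one takes the equivalence relation it generates. *)
Definition alpha_graph : graph -> graph -> Prop :=
  clos_refl_sym_trans graph renaming.

Definition utree (X : {fset V}) : Type :=
  {T : graph | unrooted_tree T /\ fv T = [set x | x \in X]%classic}.

Definition alpha (X : {fset V}) (T T' : utree X) : Prop :=
  alpha_graph (sval T) (sval T').

End Trees.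

(* Main.v *)
From Stdlib Require Import Eqdep_dec Operators_Properties.
From mathcomp Require Import zify.
Require Import Defs.

(* A tree is read as a command from any of its corollas: the corolla becomes an
   operation, and the branch beyond an edge {x, inv x} becomes a term that binds
   inv x.  The readings from two adjacent corollas are the two ways of reducing
   one cut <mu x.c | mu y.d>, so by connectedness all readings of a tree are
   equal modulo =_mu.  Every command equals a reading: by induction on its size
   it is a cut of two readings, hence a reading of the tree that grafts them.
   Conversely, commands are interpreted in a tree T' by relations: roughly, a
   command holds in T' if its operations and cuts can be sent to corollas and
   edges of T', and this is invariant under =_mu because commands are linear.
   So if readings of T and T' are equal, the reading of T holds in T', which
   yields a map T -> T' that is injective near each corolla and fixes the legs.
   As T and T' are trees, such a map is an isomorphism: it is onto since T' is
   connected, and injective since it sends walks without backtracking to walks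
   without backtracking, and these are never closed in a tree. *)

Set Implicit Arguments.
Unset Strict Implicit.
Unset Printing Implicit Defensive.

Local Open Scope fset_scope.

(** * Linear commands and substitution *)

(* Commands have no canonical normal form to compare. Contracting <mu x.c | mu y.d> on the left or,
   after (MU1), on the right gives commands without a common reduct in general. A reading therefore
   depends on a root, and independence of the root is proved only up to =_mu. In the other
   direction, a function from commands to trees would have to commute with capture-avoiding
   substitution and with the renaming of edges. A relational model only has to validate the
   equations, and the existence of a tree for each command becomes a separate induction. Two
   obstacles concern names: the trees to be grafted must not share variables, so that induction
   produces trees whose edges avoid any prescribed finite set; and an isomorphism may permute names,
   which no single renaming does, so it is factored through a fresh copy. Exceptional trees have no
   operation to root a reading at: a cut against a wire is contracted instead of grafted, and a
   degenerate model separates wires from operations. *)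
Scheme command_mut := Induction for command Sort Prop
with term_mut := Induction for term Sort Prop.
Combined Scheme command_term_ind from command_mut, term_mut.

Scheme typC_mut := Minimality for typC Sort Prop
with typT_mut := Minimality for typT Sort Prop.
Combined Scheme typ_ind from typC_mut, typT_mut.

Scheme mu_eqC_mut := Minimality for mu_eqC Sort Prop
with mu_eqT_mut := Minimality for mu_eqT Sort Prop.
Combined Scheme mu_eq_mut from mu_eqC_mut, mu_eqT_mut.

Lemma fdisjointE (K : choiceType) (A B : {fset K}) :
  [disjoint A & B] <-> (forall z, z \in A -> z \in B -> False).
Proof.
split=> [/fdisjointP dAB z /dAB /negP//|dAB].
by apply/fdisjointP => z zA; apply/negP => /(dAB z zA).
Qed.

Section Syntax.
Context (V : choiceType) (C : bijFunctor V).
Notation command := (command C).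
Notation term := (term C).
Implicit Types (c d : command) (s t : term) (z : V) (rho : V -> term).

Lemma in_bigU (X : {fset V}) (F : X -> {fset V}) z :
  z \in \big[fsetU/fset0]_(x : X) F x <-> exists x : X, z \in F x.
Proof.
split; first by case/bigfcupP => x _ zF; exists x.
by case=> x zF; apply/bigfcupP; exists x; rewrite ?mem_index_enum.
Qed.

(** The type in a typing judgement is forced to be the set of free variables, and what remains of
    typing is linearity. As a recursive predicate it computes on [Op], where [typC] would call for
    inversion of an indexed family. *)
Fixpoint linC c : Prop :=
  match c with
  | Cut s t => [/\ linT s, linT t & [disjoint fvT s & fvT t]]
  | Op X a t => (forall x : X, linT (t x)) /\
      (forall x y : X, x != y -> [disjoint fvT (t x) & fvT (t y)])
  end
with linT s : Prop :=
  match s with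
  | Var _ => True
  | Mu x c => linC c /\ x \in fvC c
  end.

Lemma typ_lin :
  (forall X c, typC X c -> X = fvC c /\ linC c) /\
  (forall X s, typT X s -> X = fvT s /\ linT s).
Proof.
apply: typ_ind => /=.
- by move=> X Y s t _ [-> ?] _ [-> ?] dXY.
- move=> X a t Y _ IH dY; have EY x : Y x = fvT (t x) by case: (IH x).
  split; first by apply: eq_bigr => x _.
  by split=> [x|x y xy]; [case: (IH x)|rewrite -!EY; apply: dY].
- by [].
- by move=> X x c _ [-> ?] xX.
Qed.

Lemma lin_typ :
  (forall c, linC c -> typC (fvC c) c) /\ (forall s, linT s -> typT (fvT s) s).
Proof.
apply: command_term_ind => /=.
- by move=> s IHs t IHt [/IHs ? /IHt ? ?]; constructor.
- by move=> X a t IH [lt dt]; apply: typ_op => // x; apply/IH/lt.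
- by move=> x _; constructor.
- by move=> x c IH [/IH ? ?]; constructor.
Qed.

Lemma typCP X c : typC X c <-> X = fvC c /\ linC c.
Proof. by split=> [/typ_lin.1//|[-> /lin_typ.1]]. Qed.

Lemma typTP X s : typT X s <-> X = fvT s /\ linT s.
Proof. by split=> [/typ_lin.2//|[-> /lin_typ.2]]. Qed.

Lemma mu_eq_typ :
  (forall X c d, mu_eqC X c d -> typC X c /\ typC X d) /\
  (forall X s t, mu_eqT X s t -> typT X s /\ typT X t).
Proof.
apply: mu_eq_mut => //=.
- by move=> X c d _ [].
- by move=> X c d e _ [? ?] _ [].
- by move=> X Y s s' t t' _ [? ?] _ [? ?] dXY; split; constructor.
- move=> X a t t' Y _ IH dY; split; apply: typ_op => // x; by case: (IH x).
- by move=> X s t _ [].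
- by move=> X s t u _ [? ?] _ [].
- by move=> X x c d _ [? ?] xX; split; constructor.
Qed.

Definition eqC c d := mu_eqC (fvC c) c d.
Definition eqT s t := mu_eqT (fvT s) s t.

Lemma eqCP X c d : mu_eqC X c d <-> X = fvC c /\ eqC c d.
Proof.
split=> [cd|[-> //]]; have [/typCP[EX _] _] := mu_eq_typ.1 _ _ _ cd.
by rewrite /eqC -EX.
Qed.

Lemma eqC_lin c d : eqC c d -> [/\ linC c, linC d & fvC c = fvC d].
Proof. by case/mu_eq_typ.1 => /typCP[_ ?] /typCP[]. Qed.

Lemma eqT_lin s t : eqT s t -> [/\ linT s, linT t & fvT s = fvT t].
Proof. by case/mu_eq_typ.2 => /typTP[_ ?] /typTP[]. Qed.

Lemma eqC_refl c : linC c -> eqC c c.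
Proof. by move=> lc; apply/mu_eqC_refl/typCP. Qed.

Lemma eqT_refl s : linT s -> eqT s s.
Proof. by move=> ls; apply/mu_eqT_refl/typTP. Qed.

Lemma eqC_sym c d : eqC c d -> eqC d c.
Proof. by move=> cd; have [_ _ E] := eqC_lin cd; rewrite /eqC -E; apply: mu_eqC_sym. Qed.

Lemma eqC_trans d c e : eqC c d -> eqC d e -> eqC c e.
Proof.
by move=> cd; have [_ _ E] := eqC_lin cd; rewrite /eqC -E; apply: mu_eqC_trans.
Qed.

Lemma eqT_trans t s u : eqT s t -> eqT t u -> eqT s u.
Proof.
by move=> st; have [_ _ E] := eqT_lin st; rewrite /eqT -E; apply: mu_eqT_trans.
Qed.

Lemma eqC_cut s s' t t' : eqT s s' -> eqT t t' ->
  [disjoint fvT s & fvT t] -> eqC (Cut s t) (Cut s' t').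
Proof. exact: mu_eqC_cut. Qed.

Lemma eqC_op (X : {fset V}) (a : C X) (t t' : X -> term) :
  (forall x : X, eqT (t x) (t' x)) ->
  (forall x y : X, x != y -> [disjoint fvT (t x) & fvT (t y)]) ->
  eqC (Op a t) (Op a t').
Proof. exact: mu_eqC_op. Qed.

Lemma eqT_mu x c d : eqC c d -> x \in fvC c -> eqT (Mu x c) (Mu x d).
Proof. exact: mu_eqT_mu. Qed.

Lemma eqC_axiom c d :
  linC c -> linC d -> fvC c = fvC d -> mu_axiomC c d -> eqC c d.
Proof. by move=> ? ? ? ?; apply: mu_eqC_axiom => //; apply/typCP. Qed.

Lemma eqT_axiom s t :
  linT s -> linT t -> fvT s = fvT t -> mu_axiomT s t -> eqT s t.
Proof. by move=> ? ? ? ?; apply: mu_eqT_axiom => //; apply/typTP. Qed.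

Lemma fv_vars :
  (forall c, fvC c `<=` varsC c) /\ (forall s, fvT s `<=` varsT s).
Proof.
apply: command_term_ind => /=.
- by move=> s IHs t IHt; apply: fsetUSS.
- move=> X a t IH; apply/fsubsetP => z /in_bigU[x zx]; apply/in_bigU.
  by exists x; apply: (fsubsetP (IH x)).
- by [].
- move=> x c IH; apply/fsubsetP => z; rewrite !inE => /andP[_ zc].
  by rewrite (fsubsetP IH _ zc) orbT.
Qed.

Lemma updE rho x s y : upd rho x s y = if y == x then s else rho y.
Proof. by []. Qed.

Lemma avoidid x (A : {fset V}) : x \notin A -> avoid x A = x.
Proof. by rewrite /avoid => /negbTE ->. Qed.

(* Thanks to [avoid] not renaming without need, this is a syntactic equality. *)
Lemma subst_id :
  (forall c rho, (forall x, x \in fvC c -> rho x = Var C x) -> substC rho c = c)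
  /\
  (forall s rho, (forall x, x \in fvT s -> rho x = Var C x) -> substT rho s = s).
Proof.
apply: command_term_ind => /=.
- move=> s IHs t IHt rho E.
  by rewrite IHs ?IHt// => x xs; apply: E; rewrite inE xs ?orbT.
- move=> X a t IH rho E; congr Op; apply/funext => x; apply: IH => z zx.
  by apply: E; apply/in_bigU; exists x.
- by move=> x rho ->; rewrite ?inE.
- move=> x c IH rho E.
  have -> : \bigcup_(y <- fvC c `\ x) fvT (rho y) = fvC c `\ x.
    apply/fsetP => z; apply/bigfcupP/idP => [[y]|zc].
      by rewrite andbT => yc; rewrite E//= inE => /eqP ->.
    by exists z; rewrite ?andbT// E//= inE.
  rewrite avoidid ?inE ?eqxx// IH// => y yc; rewrite updE.
  by case: eqVneq => [->//|yx]; apply: E; rewrite !inE yx.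
Qed.

(** Variables weigh 0, so renaming keeps the size, and contracting a cut against a variable strictly
    lowers it. This is the measure of the induction that finds a tree for each command. *)
Fixpoint sizeC c : nat :=
  match c with
  | Cut s t => (sizeT s + sizeT t).+1
  | Op X a t => (\sum_(x : X) sizeT (t x)).+1
  end
with sizeT s : nat := if s is Mu x c then (sizeC c).+1 else 0.

Lemma size_subst :
  (forall c rho, (forall x, sizeT (rho x) = 0) -> sizeC (substC rho c) = sizeC c)
  /\
  (forall s rho, (forall x, sizeT (rho x) = 0) -> sizeT (substT rho s) = sizeT s).
Proof.
apply: command_term_ind => /=.
- by move=> s IHs t IHt rho E; rewrite IHs ?IHt.
- by move=> X a t IH rho E; congr S; apply: eq_bigr => x _; apply: IH.
- by [].
- by move=> x c IH rho E; rewrite IH// => y; rewrite updE; case: eqP.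
Qed.

Section Infinite.
Hypothesis V_infinite : infinite_set [set: V]%classic.

Lemma exists_fresh (A : {fset V}) : exists z, z \notin A.
Proof.
apply: contrapT => noz; apply: V_infinite.
apply: (@sub_finite_set _ _ [set` A]) => [z _|]; last exact: finite_fset.
by apply: contrapT => /= /negP zA; apply: noz; exists z.
Qed.

Lemma avoid_notin x (A : {fset V}) : avoid x A \notin A.
Proof.
rewrite /avoid; case: ifPn => // _; have [z zA] := exists_fresh A.
exact: (@xgetPex _ x [set z | z \notin A]%classic (ex_intro _ z zA)).
Qed.

Lemma fv_subst :
  (forall c rho z, z \in fvC (substC rho c) <->
     exists2 x, x \in fvC c & z \in fvT (rho x)) /\
  (forall s rho z, z \in fvT (substT rho s) <->
     exists2 x, x \in fvT s & z \in fvT (rho x)).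
Proof.
apply: command_term_ind => /=.
- move=> s IHs t IHt rho z; rewrite inE; split.
    by case/orP => [/IHs|/IHt] [x xs zx]; exists x; rewrite // inE xs ?orbT.
  case=> x; rewrite inE => /orP[] xs zx; apply/orP; [left|right].
    by apply/IHs; exists x.
  by apply/IHt; exists x.
- move=> X a t IH rho z; split.
    case/in_bigU => x /IH[y yx zy]; exists y => //.
    by apply/in_bigU; exists x.
  case=> y /in_bigU[x yx] zy; apply/in_bigU; exists x; apply/IH.
  by exists y.
- move=> x rho z; split; first by exists x; rewrite ?inE.
  by case=> y; rewrite inE => /eqP ->.
- move=> x c IH rho z; set A := \bigcup_(y <- _) _; set w := avoid x A.
  have wA : w \notin A := avoid_notin x A.
  rewrite !inE; split.
    case/andP => zw /IH[y yc]; rewrite updE.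
    case: eqVneq => [_|yx]; first by rewrite /= inE (negbTE zw).
    by exists y => //; rewrite !inE yx.
  case=> y; rewrite !inE => /andP[yx yc] zy; apply/andP; split.
    apply: contraNneq wA => <-; apply/bigfcupP; exists y => //.
    by rewrite andbT !inE yx.
  by apply/IH; exists y; rewrite // updE (negbTE yx).
Qed.

Lemma lin_subst :
  (forall c rho, linC c -> (forall x, x \in fvC c -> linT (rho x)) ->
     (forall x y, x \in fvC c -> y \in fvC c -> x != y ->
        [disjoint fvT (rho x) & fvT (rho y)]) ->
     linC (substC rho c)) /\
  (forall s rho, linT s -> (forall x, x \in fvT s -> linT (rho x)) ->
     (forall x y, x \in fvT s -> y \in fvT s -> x != y ->
        [disjoint fvT (rho x) & fvT (rho y)]) ->
     linT (substT rho s)).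
Proof.
apply: command_term_ind => /=.
- move=> s IHs t IHt rho [ls lt dst] lr dr; split.
  + apply: IHs => // [x xs|x y xs ys]; first by apply: lr; rewrite inE xs.
    by apply: dr; rewrite inE ?xs ?ys.
  + apply: IHt => // [x xs|x y xs ys].
      by apply: lr; rewrite inE xs ?orbT.
    by apply: dr; rewrite inE ?xs ?ys orbT.
  + apply/fdisjointE => z /fv_subst.2[x xs zx] /fv_subst.2[y yt zy].
    have xy : x != y.
      apply: contraTneq (xs) => ->; apply/negP => ys.
      exact: ((fdisjointE _ _).1 dst _ ys yt).
    apply: ((fdisjointE _ _).1 (dr x y _ _ xy) z) => //.
      by rewrite inE xs.
    by rewrite inE yt orbT.
- move=> X a t IH rho [lt dt] lr dr.
  have sub x z : z \in fvT (t x) -> z \in fvC (Op a t).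
    by move=> zx; apply/in_bigU; exists x.
  split=> [x|x y xy].
    by apply: IH => // [z /sub|z w /sub ? /sub ?]; [apply: lr|apply: dr].
  apply/fdisjointE => z /fv_subst.2[x' xs zx] /fv_subst.2[y' yt zy].
  have xy' : x' != y'.
    apply: contraTneq (xs) => ->; apply/negP => ys.
    exact: ((fdisjointE _ _).1 (dt _ _ xy) _ ys yt).
  by apply: ((fdisjointE _ _).1 (dr _ _ (sub _ _ xs) (sub _ _ yt) xy') z).
- by move=> x rho _ lr _; apply: lr; rewrite inE.
- move=> x c IH rho [lc xc] lr dr.
  set A := \bigcup_(y <- _) _; set w := avoid x A.
  have wA : w \notin A := avoid_notin x A.
  have wr y : y \in fvC c -> y != x -> w \notin fvT (rho y).
    move=> yc yx; apply: contraNN wA => wy; apply/bigfcupP; exists y => //.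
    by rewrite !inE yx yc.
  split; last first.
    by apply/fv_subst.1; exists x; rewrite // updE eqxx /= inE.
  apply: IH => // [y yc|y z yc zc yz]; rewrite !updE.
    by case: eqVneq => // yx; apply: lr; rewrite !inE yx.
  case: (eqVneq y x) => [yx|yx]; case: (eqVneq z x) => [zx|zx].
  + by rewrite yx zx eqxx in yz.
  + by apply/fdisjointE => v; rewrite inE => /eqP -> /(negP (wr _ zc zx)).
  + by apply/fdisjointE => v vy; rewrite inE => /eqP vw; move: vy; rewrite vw => /(negP (wr _ yc yx)).
  + by apply: dr; rewrite ?inE ?yx ?zx.
Qed.

Lemma fv_subst1 c s x : x \in fvC c ->
  fvC (subst1 c s x) = (fvC c `\ x) `|` fvT s.
Proof.
move=> xc; apply/fsetP => z; rewrite /subst1; apply/idP/idP.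
  case/fv_subst.1 => y yc; rewrite updE; case: eqVneq => [_ zs|yx]; rewrite !inE.
    by rewrite zs orbT.
  by move/eqP ->; rewrite yx yc.
move=> zc; apply/fv_subst.1; move: zc; rewrite !inE => /orP[/andP[zx zc]|zs].
  by exists z; rewrite // updE (negbTE zx) /= inE.
by exists x; rewrite // updE eqxx.
Qed.

Lemma lin_subst1 c s x : linC c -> linT s -> [disjoint fvC c `\ x & fvT s] ->
  linC (subst1 c s x).
Proof.
move=> lc ls /fdisjointE dcs; apply: lin_subst.1 => // [y _|y z yc zc yz].
  by rewrite updE; case: eqP.
rewrite !updE; case: (eqVneq y x) => [yx|yx]; case: (eqVneq z x) => [zx|zx].
- by rewrite yx zx eqxx in yz.
- apply/fdisjointE => v vs; rewrite inE => /eqP vz.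
  by apply: (dcs v) => //; rewrite vz !inE zx.
- apply/fdisjointE => v; rewrite inE => /eqP -> ys.
  by apply: (dcs y) => //; rewrite !inE yx.
- by rewrite /= fdisjoint1X inE.
Qed.

Lemma eqC_MU1 s t : linC (Cut s t) -> eqC (Cut s t) (Cut t s).
Proof.
move=> l; apply: eqC_axiom => //=; last exact: MU1; last by rewrite fsetUC.
by case: l => *; split=> //; rewrite fdisjoint_sym.
Qed.

Lemma eqC_MU2 x c s : linC (Cut (Mu x c) s) ->
  eqC (Cut (Mu x c) s) (subst1 c s x).
Proof.
move=> l; have /= [[lc xc] ls dcs] := l.
by apply: eqC_axiom; [|apply: lin_subst1|rewrite fv_subst1|constructor].
Qed.

Lemma eqT_MU3 x y c : linC c -> x \in fvC c -> y \notin varsC c `\ x ->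
  eqT (Mu x c) (Mu y (subst1 c (Var C y) x)).
Proof.
move=> lc xc yc.
have yf : y \notin fvC c `\ x.
  by apply: contraNN yc; rewrite !inE => /andP[->] /(fsubsetP (fv_vars.1 c)).
apply: eqT_axiom => /=; last exact: MU3.
- by [].
- split; last by rewrite fv_subst1// !inE eqxx orbT.
  by apply: lin_subst1; rewrite //= fdisjointX1.
- rewrite fv_subst1//=; apply/fsetP => z; rewrite !inE.
  case: (eqVneq z y) => [->|_]; last by rewrite orbF.
  by move: yf; rewrite !inE => /negbTE.
Qed.

Lemma fv_act (X Y : {fset V}) (sigma : fbij Y X) (a : C X) (t : X -> term) :
  fvC (Op (act sigma a) (fun y => t (sigma y))) = fvC (Op a t).
Proof.
apply/fsetP => z; apply/idP/idP => /in_bigU[x zx]; apply/in_bigU.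
  by exists (sigma x).
by case: (fbij_bij sigma) => g _ K; exists (g x); rewrite K.
Qed.

Lemma eqC_MU4 (X Y : {fset V}) (sigma : fbij Y X) (a : C X) (t : X -> term) :
  linC (Op a t) -> eqC (Op a t) (Op (act sigma a) (fun y => t (sigma y))).
Proof.
move=> l; apply: eqC_axiom => //; last exact: MU4; last by rewrite fv_act.
case: l => lt dt; split=> [x|x y xy]; first exact: lt.
apply: dt.
by rewrite (inj_eq (bij_inj (fbij_bij sigma))).
Qed.

End Infinite.
End Syntax.

(** * A relational model of the equations *)

Section Model.
Context (V : choiceType) (C : bijFunctor V) (E : Type) (iota : E -> E).
Hypothesis iotaK : involutive iota.
Variable interp : forall X : {fset V}, C X -> (X -> E) -> Prop.
Hypothesis interp_act : forall (X Y : {fset V}) (sigma : fbij Y X) (a : C X) g,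
  interp a g <-> interp (act sigma a) (fun y => g (sigma y)).

Definition env_upd (rho : V -> E) (x : V) (e : E) : V -> E :=
  fun y => if y == x then e else rho y.

(** Values are half-edges. A cut is an edge, so its two sides sit at opposite ends; the variable
    bound by a term placed at [e] names the other end [iota e]. With these conventions (MU2) only
    reindexes the existential over [e]. *)
Fixpoint denC (c : command C) (rho : V -> E) : Prop :=
  match c with
  | Cut s t => exists e, denT s rho e /\ denT t rho (iota e)
  | Op X a t => exists g : X -> E, interp a g /\ forall x, denT (t x) rho (g x)
  end
with denT (s : term C) (rho : V -> E) (e : E) : Prop :=
  match s with
  | Var x => rho x = e
  | Mu x c => denC c (env_upd rho x (iota e))
  end.

Lemma den_coincidence :
  (forall (c : command C) rho rho',
     (forall x, x \in fvC c -> rho x = rho' x) -> denC c rho -> denC c rho') /\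
  (forall (s : term C) rho rho' e,
     (forall x, x \in fvT s -> rho x = rho' x) -> denT s rho e -> denT s rho' e).
Proof.
apply: command_term_ind => /=.
- move=> s IHs t IHt rho rho' rr [e [se te]]; exists e; split.
    by apply: IHs se => x xs; apply: rr; rewrite inE xs.
  by apply: IHt te => x xt; apply: rr; rewrite inE xt orbT.
- move=> X a t IH rho rho' rr [g [ag tg]]; exists g; split=> // x.
  by apply: IH (tg x) => z zx; apply: rr; apply/in_bigU; exists x.
- by move=> x rho rho' e -> //; rewrite inE.
- move=> x c IH rho rho' e rr; apply: IH => y yc; rewrite /env_upd.
  by case: eqVneq => // yx; apply: rr; rewrite !inE yx.
Qed.

Section Infinite.
Hypothesis V_infinite : infinite_set [set: V]%classic.

(* Linearity is what allows a single valuation [v] to record the choices made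
   at all the occurrences of variables. *)
Lemma den_subst :
  (forall (c : command C) (sigma : V -> term C) rho, linC c ->
     denC (substC sigma c) rho <->
     exists2 v, forall x, x \in fvC c -> denT (sigma x) rho (v x) & denC c v) /\
  (forall (s : term C) (sigma : V -> term C) rho e, linT s ->
     denT (substT sigma s) rho e <->
     exists2 v, forall x, x \in fvT s -> denT (sigma x) rho (v x) & denT s v e).
Proof.
apply: command_term_ind => /=.
- move=> s IHs t IHt sigma rho [ls lt dst]; split.
    case=> e [/IHs-/(_ ls)[v1 s1 e1] /IHt-/(_ lt)[v2 s2 e2]].
    exists (fun x => if x \in fvT s then v1 x else v2 x).
      move=> x; rewrite inE; case: ifP => [xs _|_ /=]; [exact: s1|exact: s2].
    exists e; split; first by apply: den_coincidence.2 e1 => x ->.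
    apply: den_coincidence.2 e2 => x xt; case: ifP => // xs.
    by case: ((fdisjointE _ _).1 dst x).
  case=> v sv [e [se te]]; exists e; split.
    by apply/IHs => //; exists v => // x xs; apply: sv; rewrite inE xs.
  by apply/IHt => //; exists v => // x xs; apply: sv; rewrite inE xs orbT.
- move=> X a t IH sigma rho [lt dt]; split.
    case=> g [ag tg].
    have /choice[v vP] (x : X) : exists v,
        (forall y, y \in fvT (t x) -> denT (sigma y) rho (v y)) /\
        denT (t x) v (g x).
      by have [v ? ?] := (IH x sigma rho (g x) (lt x)).1 (tg x); exists v.
    have /choice[w wP] (y : V) : exists e, forall x : X, y \in fvT (t x) -> e = v x y.
      case: (pselect (exists x : X, y \in fvT (t x))) => [[x yx]|ny].
        exists (v x y) => x' yx'; congr (v _ y); apply: contrapT => /eqP xx'.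
        exact: ((fdisjointE _ _).1 (dt _ _ xx') _ yx yx').
      by exists (rho y) => x yx; case: ny; exists x.
    exists w; first by move=> y /in_bigU[x yx]; rewrite (wP _ _ yx); apply: (vP x).1.
    exists g; split=> // x; apply: den_coincidence.2 (vP x).2 => y yx.
    exact/esym/wP.
  case=> v sv [g [ag tg]]; exists g; split=> // x; apply/IH => //.
  by exists v => // y yx; apply: sv; apply/in_bigU; exists x.
- move=> x sigma rho e _; split=> [se|[v sv <-]]; last by apply: sv; rewrite inE.
  by exists (fun=> e) => // y; rewrite inE => /eqP ->.
- move=> x c IH sigma rho e [lc xc].
  set A := \bigcup_(y <- _) _; set z := avoid x A.
  have zA : z \notin A := avoid_notin V_infinite x A.
  have zs y : y \in fvC c -> y != x -> z \notin fvT (sigma y).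
    move=> yc yx; apply: contraNN zA => zy; apply/bigfcupP; exists y => //.
    by rewrite !inE yx yc.
  have den_env y e' : y \in fvC c -> y != x ->
      denT (sigma y) (env_upd rho z (iota e)) e' <-> denT (sigma y) rho e'.
    move=> yc yx; split; apply: den_coincidence.2 => w wy; rewrite /env_upd;
    by case: eqVneq => // wz; move: wy; rewrite wz => /(negP (zs _ yc yx)).
  split.
    case/IH => // v sv cv; exists v.
      move=> y; rewrite !inE => /andP[yx yc]; apply/den_env => //.
      by have := sv y yc; rewrite updE (negbTE yx).
    apply: den_coincidence.1 cv => y yc; rewrite /env_upd.
    case: eqVneq => // ->; have := sv x xc.
    by rewrite updE eqxx /= /env_upd eqxx.
  case=> v sv cv; apply/IH => //; exists (env_upd v x (iota e)) => // y yc.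
  rewrite updE {2}/env_upd; case: eqVneq => [_|yx] /=.
    by rewrite /env_upd eqxx.
  by apply/den_env => //; apply: sv; rewrite !inE yx.
Qed.

(** The witness [e] is the value taken at the occurrence of [x]. An occurrence is required:
    otherwise the substitution would discard [s], while the right-hand side still asks [s] to hold
    somewhere. *)
Lemma den_subst1 (c : command C) s x rho : linC c -> x \in fvC c ->
  denC (subst1 c s x) rho <->
  exists2 e, denT s rho e & denC c (env_upd rho x e).
Proof.
move=> lc xc; rewrite /subst1; split.
  case/den_subst.1 => // v sv cv; exists (v x).
    by have := sv x xc; rewrite updE eqxx.
  apply: den_coincidence.1 cv => y yc; rewrite /env_upd; case: eqVneq => [->//|yx].
  by have := sv y yc; rewrite updE (negbTE yx) /=.
case=> e se ce; apply/den_subst.1 => //; exists (env_upd rho x e) => // y yc.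
by rewrite updE /env_upd; case: eqVneq.
Qed.

Lemma den_axiomC (c d : command C) rho : linC c -> mu_axiomC c d ->
  denC c rho <-> denC d rho.
Proof.
move=> lc cd; case: cd lc => /=.
- move=> s t _; split=> -[e [se te]]; exists (iota e);
  by rewrite iotaK.
- move=> x c' s [[lc xc] _ _]; apply: iff_trans (iff_sym (den_subst1 _ _ lc xc)).
  split=> [[e [ce se]]|[e se ce]]; first by exists (iota e).
  by exists (iota e); rewrite iotaK.
- move=> X Y sigma a t _; case: (fbij_bij sigma) => f sK fK; split.
    case=> g [ag tg]; exists (fun y => g (sigma y)); split=> //.
    by rewrite -interp_act.
  case=> g [ag tg]; exists (fun x => g (f x)); split.
    apply/(interp_act sigma) => /=; suff -> : (fun y => g (f (sigma y))) = g by [].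
    by apply/funext => y; rewrite sK.
  by move=> x; have := tg (f x); rewrite fK.
Qed.

Lemma den_axiomT (s t : term C) rho e : linT s -> mu_axiomT s t ->
  denT s rho e <-> denT t rho e.
Proof.
move=> ls st; case: st ls => x y c yc /= [lc xc].
apply: iff_trans (iff_sym (den_subst1 _ _ lc xc)); split.
  move=> ce; exists (iota e); first by rewrite /= /env_upd eqxx.
  apply: den_coincidence.1 ce => z zc; rewrite /env_upd; case: eqVneq => // zx.
  case: eqVneq => // zy; move: yc.
  by rewrite -zy !inE zx (fsubsetP ((fv_vars C).1 c) _ zc).
case=> e'; rewrite /= {1}/env_upd eqxx => <-; apply: den_coincidence.1 => z zc.
rewrite /env_upd; case: eqVneq => // zx; case: eqVneq => // zy; move: yc.
by rewrite -zy !inE zx (fsubsetP ((fv_vars C).1 c) _ zc).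
Qed.

(** Soundness turns every model into an invariant of =_mu. It is applied to the half-edges of a
    tree, and to a one-point model that separates wires from operations. *)
Lemma den_mu_eq :
  (forall X (c d : command C), mu_eqC X c d ->
     forall rho, denC c rho <-> denC d rho) /\
  (forall X (s t : term C), mu_eqT X s t ->
     forall rho e, denT s rho e <-> denT t rho e).
Proof.
apply: mu_eq_mut => /=.
- by move=> X c d /typCP[_ lc] _ cd rho; apply: den_axiomC.
- by [].
- by move=> X c d _ IH rho; apply: iff_sym.
- by move=> X c d e _ IH _ IH' rho; apply: iff_trans (IH rho) _.
- move=> X Y s s' t t' _ IHs _ IHt _ rho.
  by split=> -[e [/IHs se /IHt te]]; exists e.
- move=> X a t t' Y _ IH _ rho.
  by split=> -[g [ag tg]]; exists g; split=> // x; apply/IH.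
- by move=> X s t /typTP[_ ls] _ st rho e; apply: den_axiomT.
- by [].
- by move=> X s t _ IH rho e; apply: iff_sym.
- by move=> X s t u _ IH _ IH' rho e; apply: iff_trans (IH rho e) _.
- by move=> X x c d _ IH _ rho e; apply: IH.
Qed.

End Infinite.
End Model.

(** * Walks without backtracking in a tree *)

Section Walks.
Context (V : choiceType) (C : bijFunctor V) (T : graph C).
Notation inv := (inv T).

Lemma invK : involutive inv.
Proof. exact: inv_involutive. Qed.

Lemma inv_vars x : vars T x -> vars T (inv x).
Proof.
move=> xT; apply: contrapT => ixT; apply: (ixT).
by rewrite -(inv_outside ixT) invK.
Qed.

Lemma corollas_eq K L x : corollas T K -> corollas T L ->
  x \in fv_cor K -> x \in fv_cor L -> K = L.
Proof.
move=> TK TL xK xL; apply: contrapT => /(corollas_disjoint TK TL)/fdisjointE.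
by move/(_ x xK xL).
Qed.

Definition co x y :=
  exists2 K, corollas T K & (x \in fv_cor K) && (y \in fv_cor K).

Lemma co_sym x y : co x y -> co y x.
Proof. by case=> K TK xy; exists K => //; rewrite andbC. Qed.

Lemma co_mem K x y : corollas T K -> x \in fv_cor K -> co x y -> y \in fv_cor K.
Proof.
by move=> TK xK [L TL /andP[xL yL]]; rewrite (corollas_eq TK TL xK xL).
Qed.

Lemma co_trans y x z : co x y -> co y z -> co x z.
Proof.
by case=> K TK /andP[xK yK] /(co_mem TK yK) zK; exists K; rewrite // xK.
Qed.

Lemma co_vars x y : co x y -> vars T x /\ vars T y.
Proof. by case=> K TK /andP[xK yK]; split; exists K. Qed.

(* A walk without backtracking is recorded by the half-edges through which it
   leaves the corollas that it visits. *)
Definition step x y := [/\ inv x <> x, y <> inv x & co (inv x) y].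

Definition reach := clos_refl_trans_n1 V step.

Lemma reach_trans y x z : reach x y -> reach y z -> reach x z.
Proof. by move=> xy; elim=> // u v uv _; apply: rtn1_trans. Qed.

Lemma step_reach x y : step x y -> reach x y.
Proof. by move=> xy; apply: rtn1_trans (rtn1_refl _ _ _). Qed.

(** Walking backwards exchanges the two halves of every edge. The last half-edge must belong to an
    edge, since a leg cannot be crossed. *)
Lemma step_rev x y : step x y -> inv y <> y -> step (inv y) (inv x).
Proof.
case=> ix yx xy iy; rewrite /step invK; split.
- exact: nesym.
- exact: nesym.
- exact: co_sym.
Qed.

Lemma reach_nfix x y : reach x y -> inv y <> y -> inv x <> x.
Proof. by elim=> // u v [iu _ _] _ /(_ iu). Qed.

Lemma reach_rev x y : reach x y -> inv y <> y -> reach (inv y) (inv x).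
Proof.
elim=> [_|u v uv _ IH iv]; first exact: rtn1_refl.
have [iu _ _] := uv; apply: reach_trans (IH iu).
exact/step_reach/step_rev.
Qed.

Lemma reach_last x z : reach x z -> x = z \/ exists2 y, reach x y & step y z.
Proof. by case=> [|y u yu xy]; [left|right; exists y]. Qed.

Lemma reach_vars x y : vars T x -> reach x y -> vars T y.
Proof. by move=> xT; elim=> // u v [_ _ /co_vars[]]. Qed.

Lemma reach_walk x y : reach x y -> exists n (w : nat -> V),
  [/\ w 0 = x, w n = y & forall i, i < n -> step (w i) (w i.+1)].
Proof.
elim=> [|u v uv _ [n [w [w0 wn ws]]]]; first by exists 0, (fun=> x).
exists n.+1, (fun i => if i <= n then w i else v); split=> //.
  by rewrite ltnn.
move=> i; rewrite ltnS => i_n; have := i_n; rewrite {1}leq_eqVlt => /predU1P[->|ni].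
  by rewrite leqnn ltnn wn.
by rewrite (ltnW ni) ni; apply: ws.
Qed.

Lemma joins_step x K L : corollas T K -> corollas T L -> x \in fv_cor K ->
  inv x \in fv_cor L -> inv x <> x -> joins T [fset x; inv x] K L.
Proof. by move=> *; split=> //; exists x. Qed.

Section Tree.
Hypothesis tree : ordinary_tree T.

(** By induction on the length: if two of the corollas left by the walk coincide, the part between
    them is a shorter closed walk. Otherwise the walk is a loop, a double edge or a cycle, according
    as it has one, two or more edges. *)
Lemma no_closed_walk x y : vars T x -> reach x y -> inv y <> y ->
  ~ co x (inv y).
Proof.
move=> + /reach_walk[n [w []]]; rewrite /not; have [m] := ubnP n.
elim: m n w x y => // m IH n w x y; rewrite ltnS => nm xT w0 wn ws iy xy.
have wT i : i <= n -> vars T (w i).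
  case: i => [|i ni]; first by rewrite w0.
  by have [_ _ /co_vars[]] := ws i ni.
have nfix i : i <= n -> inv (w i) <> w i.
  by rewrite leq_eqVlt => /predU1P[->|/ws[]//]; rewrite wn.
have [own ownP] : exists own, forall i, i <= n ->
    corollas T (own i) /\ w i \in fv_cor (own i).
  suff /choice[own ownP] : forall i, exists K, i <= n ->
    corollas T K /\ w i \in fv_cor K by exists own.
  move=> i; case: (leqP i n) => [/wT[K TK wK]|_]; first by exists K.
  by have [K _] := corollas_nonempty T; exists K.
have own_inj i j : i < j -> j <= n -> own i <> own j.
  move=> ij jn E; have /ownP[Ti wi] : i <= n by lia.
  have [Tj wj] := ownP _ jn.
  (* The closed subwalk ends with [w j.-1]: crossing that edge leads to [own j], which is
     [own i]. *)
  have jn1 : j.-1 < n by lia.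
  have [jfix _ jco] := ws _ jn1; rewrite (ltn_predK ij) in jco.
  apply: (IH (j.-1 - i)%N (fun k => w (i + k)%N) (w i) (w j.-1)) => //.
  - by lia.
  - by apply: wT; lia.
  - by rewrite addn0.
  - by congr w; lia.
  - by move=> k kj; rewrite addnS; apply: ws; lia.
  - by apply: co_sym; apply: co_trans jco _; exists (own j); rewrite // -E wi E wj.
have own_step i : i < n -> inv (w i) \in fv_cor (own i.+1).
  move=> ni; have [_ _ /co_sym wco] := ws _ ni.
  by have [To wo] := ownP _ ni; apply: co_mem wco.
have own_last : inv (w n) \in fv_cor (own 0).
  by have [To wo] := ownP 0 isT; apply: co_mem To wo _; rewrite w0 wn.
have [_ _ noloop nomult nocyc] := tree.
have own_adj i j : i <= n -> j <= n -> inv (w i) \in fv_cor (own j) ->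
    joins T [fset w i; inv (w i)] (own i) (own j).
  move=> i_n j_n wij; have [Ti wi] := ownP _ i_n; have [Tj wj] := ownP _ j_n.
  by apply: joins_step => //; apply: nfix.
case: n => [|[|n]] in nm wn ws wT nfix ownP own_inj own_step own_last own_adj *.
- exact: (noloop _ _ (own_adj 0 0 isT isT own_last)).
- have j01 := own_adj 0 1 isT isT (own_step 0 isT).
  have j10 := own_adj 1 0 isT isT own_last.
  have [Tj wj] := ownP 1 isT; have [To wo] := ownP 0 isT.
  have j01' : joins T [fset w 1; inv (w 1)] (own 0) (own 1).
    split=> //; exists (inv (w 1)); rewrite invK; split=> //; last by rewrite fsetUC.
    exact/nesym/nfix.
  (* If the two edges coincide, then [w 1] is either [w 0], so that the corollas agree, or
     [inv (w 0)], which is a backtrack. *)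
  have := nomult _ _ _ _ j01' j01 => /fsetP/(_ (w 1)); rewrite !inE eqxx /=.
  move/esym/orP=> [] /eqP E.
    by apply: (own_inj 0 1) => //; apply: corollas_eq To Tj wo _; rewrite -E.
  by have [_ /(_ E)] := ws 0 isT.
apply: (nocyc n.+3 (fun i => own (i : nat))) => // [i j|i].
  move=> E; apply/val_inj; case: (ltngtP i j) => // ij.
    by case: (own_inj _ _ ij); rewrite // -ltnS.
  by case: (own_inj _ _ ij); rewrite // -ltnS.
have i_n : i < n.+3 by [].
rewrite /ordS /=; case: (eqVneq (i : nat) n.+2) => [->|ni].
  by rewrite modnn; exists [fset w n.+2; inv (w n.+2)]; apply: own_adj.
have ii : i.+1 < n.+3 by lia.
rewrite modn_small//; exists [fset w i; inv (w i)].
by apply: own_adj => //; apply: own_step; lia.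
Qed.

Section Root.
Variable K0 : corolla C.
Hypothesis TK0 : corollas T K0.

(** Rooting the tree at [K0] orients it: of each edge exactly one half satisfies [rreach], the one
    on the side of the root. That both halves never do is [rreach_inv]; that one does, and that
    every leg does, is [vars_cover]. *)
Definition rreach z := exists2 x, x \in fv_cor K0 & reach x z.

Lemma rreach_root x : x \in fv_cor K0 -> rreach x.
Proof. by move=> xK; exists x => //; apply: rtn1_refl. Qed.

Lemma rreach_step x y : rreach x -> step x y -> rreach y.
Proof. by case=> z zK zx xy; exists z => //; apply: rtn1_trans zx. Qed.

Lemma rreach_vars x : rreach x -> vars T x.
Proof. by case=> y yK; apply: reach_vars; exists K0. Qed.

Lemma rreach_inv_root x : rreach x -> inv x <> x -> inv x \notin fv_cor K0.
Proof.
case=> y yK yx ix; apply/negP => iK; apply: (no_closed_walk _ yx ix).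
  by exists K0.
by exists K0; rewrite // yK.
Qed.

(** A walk from the root to [x], continued by the reverse of a walk from the root to [inv x], would
    return to the root without backtracking. *)
Lemma rreach_inv x : rreach x -> inv x <> x -> ~ rreach (inv x).
Proof.
case=> y yK yx ix [z zK zx].
have iix : inv (inv x) <> inv x by rewrite invK; apply: nesym.
have zfix := reach_nfix zx iix.
have xz := reach_rev zx iix; rewrite invK in xz.
apply: (no_closed_walk _ (reach_trans yx xz)).
- by exists K0.
- by rewrite invK; apply: nesym.
- by rewrite invK; exists K0; rewrite // yK.
Qed.

(** Two distinct predecessors would let a walk arrive through [x] and leave through [inv y], then
    follow the other walk back to the root. *)
Lemma rreach_pred x y z : rreach x -> rreach y -> step x z -> step y z -> x = y.
Proof.
case=> x0 x0K x0x [y0 y0K y0y] [ix zx xz] [iy zy yz]; apply: contrapT => xy.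
have xy' : step x (inv y).
  split=> // [E|]; last exact: co_trans xz (co_sym yz).
  by apply: xy; rewrite -[x]invK -E invK.
have yy0 := reach_rev y0y iy; have y0fix := reach_nfix y0y iy.
apply: (no_closed_walk _ (reach_trans (rtn1_trans _ _ _ _ _ xy' x0x) yy0)).
- by exists K0.
- by rewrite invK; apply: nesym.
- by rewrite invK; exists K0; rewrite // x0K.
Qed.

Lemma rreach_step_root x y : rreach x -> step x y -> y \notin fv_cor K0.
Proof.
move=> x0x [ix _ xy]; apply/negP => yK.
by case/negP: (rreach_inv_root x0x ix); apply: co_mem yK (co_sym xy).
Qed.

Lemma rreach_cover K : corollas T K ->
  K = K0 \/ exists2 x, rreach x & inv x <> x /\ inv x \in fv_cor K.
Proof.
have [_ conn _ _ _] := tree.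
move=> /(conn _ _ TK0) K0K; elim: (clos_rt_rtn1 _ _ _ _ K0K) => [|L M].
  by left.
case=> e [TL TM [x [xL ixM ix _]]] _ [EL|[y yr [iy yL]]].
  by right; exists x => //; apply: rreach_root; rewrite -EL.
(* Connectedness supplies paths that may backtrack. If the new edge is the one just crossed, the
   last half-edge is dropped from the walk instead of a new one being added. *)
case: (pselect (x = inv y)) => [xy|xy]; last first.
  right; exists x => //; apply: rreach_step yr _.
  by split=> //; exists L; rewrite // yL.
case: yr => y0 y0K /reach_last[y0y|[z y0z [iz _ co_y]]].
  by left; apply: corollas_eq TM TK0 ixM _; rewrite xy invK -y0y.
right; exists z; first by exists y0.
split=> //; apply: co_mem TM ixM _; rewrite xy invK.
exact: co_sym.
Qed.

Lemma vars_cover x : vars T x -> rreach x \/ (inv x <> x /\ rreach (inv x)).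
Proof.
case=> K TK xK; case: (rreach_cover TK) => [E|[y yr [iy yK]]].
  by left; apply: rreach_root; rewrite -E.
case: (pselect (x = inv y)) => [->|xy].
  by right; rewrite invK; split=> // /esym.
by left; apply: rreach_step yr _; split=> //; exists K; rewrite // yK.
Qed.

End Root.

(** With the common corolla as root, predecessors are unique, so both walks to [z] retrace the same
    path back to the same first half-edge. This is what makes readings linear. *)
Lemma reach_disjoint x y z : co x y -> reach x z -> reach y z -> x = y.
Proof.
case=> K TK /andP[xK yK] xz; have xr := rreach_root xK; have yr := rreach_root yK.
elim: xz => [/reach_last[//|[u yu ux]]|u v uv xu IH /reach_last[yv|[w yw wv]]].
- by case/negP: (rreach_step_root TK (ex_intro2 _ _ y yK yu) ux).
- case/negP: (rreach_step_root TK (ex_intro2 _ _ x xK xu) uv).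
  by rewrite -yv.
apply: IH; rewrite (rreach_pred TK _ _ uv wv) //; first by exists x.
by exists y.
Qed.

Lemma vars_finite : exists A : {fset V}, forall x, vars T x <-> x \in A.
Proof.
have /finite_fsetP[A AE] : finite_set (vars T).
  suff -> : vars T =
      (\bigcup_(K in corollas T) [set` fv_cor K])%classic.
    by apply: bigcup_finite => [|K _]; [exact: corollas_finite|exact: finite_fset].
  by apply/seteqP; split=> x [K TK xK]; exists K.
by exists A => x; rewrite AE.
Qed.

(* The half-edges that can be reached from [x] strictly decrease along a walk
   without backtracking. *)
Lemma step_wf x (P : V -> Prop) : vars T x ->
  (forall x, vars T x -> (forall y, step x y -> P y) -> P x) -> P x.
Proof.
move=> xT PI; have [A AP] := vars_finite.
pose B x := [fset y in A | `[< reach x y >]].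
have [n] := ubnP #|` B x|; elim: n => // n IH in x xT *; rewrite ltnS => Bn.
apply: PI => // y xy; have [ix yx co_xy] := xy.
have yT : vars T y by case: (co_vars co_xy).
apply: IH => //; apply: leq_trans Bn; apply: fproper_ltn_card.
rewrite fproperE; apply/andP; split.
  apply/fsubsetP => z; rewrite !inE => /andP[-> /asboolP yz].
  by apply/asboolP; apply: reach_trans (step_reach xy) yz.
apply/negP => /fsubsetP/(_ x); rewrite !inE.
move: xT => /AP -> /=.
have -> : `[< reach x x >] by apply/asboolP; apply: rtn1_refl.
move=> /(_ isT)/asboolP yrx.
exact: (no_closed_walk yT yrx ix (co_sym co_xy)).
Qed.

End Tree.
End Walks.

(** * Reading a tree as a command *)

Section Plug.
Context (V : choiceType) (C : bijFunctor V).
Hypothesis V_infinite : infinite_set [set: V]%classic.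

Definition setf (X : {fset V}) (t : X -> term C) (x : X) (s : term C) : X -> term C :=
  fun y => if y == x then s else t y.

Lemma setf_eq (X : {fset V}) (t : X -> term C) x s : setf t x s x = s.
Proof. by rewrite /setf eqxx. Qed.

Lemma setf_neq (X : {fset V}) (t : X -> term C) (x y : X) s :
  y != x -> setf t x s y = t y.
Proof. by rewrite /setf => /negbTE ->. Qed.

Lemma lin_setf (X : {fset V}) (a : C X) (t : X -> term C) (x : X) z :
  linC (Op a t) -> (forall y, y != x -> z \notin fvT (t y)) ->
  linC (Op a (setf t x (Var C z))).
Proof.
move=> [lt dt] zt; split=> [y|y y' yy']; rewrite /setf; first by case: eqP => // _; apply: lt.
case: (eqVneq y x) => [yx|yx]; case: (eqVneq y' x) => [yx'|yx'] /=.
- by rewrite yx yx' eqxx in yy'.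
- by rewrite fdisjoint1X; apply: zt.
- by rewrite fdisjointX1; apply: zt.
- exact: dt.
Qed.

Lemma subst1_setf (X : {fset V}) (a : C X) (t : X -> term C) (x : X) z s :
  (forall y, y != x -> z \notin fvT (t y)) ->
  subst1 (Op a (setf t x (Var C z))) s z = Op a (setf t x s).
Proof.
move=> zt; rewrite /subst1 /=; congr Op; apply/funext => y.
case: (eqVneq y x) => [->|yx]; first by rewrite !setf_eq /= updE eqxx.
rewrite !setf_neq// (subst_id C).2// => w wy; rewrite updE.
by case: eqVneq => // wz; move: wy; rewrite wz => /(negP (zt _ yx)).
Qed.

Lemma fv_setf (X : {fset V}) (a : C X) (t : X -> term C) (x : X) z :
  z \in fvC (Op a (setf t x (Var C z))).
Proof. by apply/in_bigU; exists x; rewrite setf_eq /= inE. Qed.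

(** This is (MU2) read backwards: any one argument of an operation can be pulled out into a cut,
    leaving a fresh variable in its place. *)
Lemma eqC_plug (X : {fset V}) (a : C X) (t : X -> term C) (x : X) z :
  linC (Op a t) -> (forall y, y != x -> z \notin fvT (t y)) ->
  eqC (Op a t) (Cut (Mu z (Op a (setf t x (Var C z)))) (t x)).
Proof.
move=> lt zt; have [ltx dt] := lt.
have lm := lin_setf lt zt.
have E : subst1 (Op a (setf t x (Var C z))) (t x) z = Op a t.
  rewrite subst1_setf//; congr Op; apply/funext => y; rewrite /setf.
  by case: eqP => [->|].
apply: eqC_sym; rewrite -[X in eqC _ X]E; apply: eqC_MU2 => //.
split; [by split=> //; apply: fv_setf|exact: ltx|].
apply/fdisjointE => w; rewrite /= !inE => /andP[wz /in_bigU[y wy]] wx.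
case: (eqVneq y x) wy => [->|yx]; first by rewrite setf_eq inE (negbTE wz).
by rewrite setf_neq// => wy; apply: ((fdisjointE _ _).1 (dt _ _ yx) w).
Qed.

End Plug.

Lemma Ordinary_inj (V : choiceType) (C : bijFunctor V) (X : {fset V}) (a b : C X) :
  Ordinary a = Ordinary b -> a = b.
Proof.
move=> E; apply: (@inj_pair2_eq_dec _ (fun Y Z => decP eqP) (obj C)).
by case: E.
Qed.

Section Reading.
Context (V : choiceType) (C : bijFunctor V).
Hypothesis V_infinite : infinite_set [set: V]%classic.
Variable T : graph C.
Notation inv := (inv T).

(* [out x s]: [s] is the part of [T] seen when leaving through [x] the corolla
   that contains [x]; the bound variables of [s] are half-edges of [T]. *)
Inductive out : V -> term C -> Prop :=
| out_leg x : inv x = x -> out x (Var C x)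
| out_edge x (Y : {fset V}) (b : C Y) (t : Y -> term C) :
    inv x <> x -> corollas T (Ordinary b) -> inv x \in Y ->
    (forall y : Y, val y <> inv x -> out (val y) (t y)) ->
    (forall y : Y, val y = inv x -> t y = Var C (inv x)) ->
    out x (Mu (inv x) (Op b t)).

Inductive reads : command C -> Prop :=
| reads_op (Y : {fset V}) (b : C Y) (t : Y -> term C) :
    corollas T (Ordinary b) -> (forall y : Y, out (val y) (t y)) ->
    reads (Op b t)
| reads_wire (e : {fset V}) (e2 : #|` e| == 2) x y :
    corollas T (Special C e2) -> e = [fset x; y] -> inv x = x -> inv y = y ->
    reads (Cut (Var C x) (Var C y)).

(** The equality is syntactic: binders and index sets carry the names of [T], and the corolla beyond
    an edge is unique because corollas are disjoint. *)
Lemma out_unique x s s' : out x s -> out x s' -> s = s'.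
Proof.
move=> xs; elim: xs s' => {x s} [x ix|x Y b t ix Tb xY tout IH tvar] s' xs'.
  by case: xs' ix => // y Z c u iy _ _ _ _ /iy.
case: xs' ix Tb xY tout IH tvar => [y iy /(_ iy)//|y Z c u iy Tc yZ uout uvar].
move=> _ Tb yY tout IH tvar; have E := corollas_eq Tb Tc yY yZ.
have YZ : Y = Z := congr1 (@fv_cor V C) E; case: Z / YZ c u Tc yZ uout uvar E.
move=> c u Tc yZ uout uvar /Ordinary_inj bc; rewrite -bc; congr (Mu _ (Op _ _)).
apply/funext => z; case: (pselect (val z = inv y)) => zy.
  by rewrite tvar ?uvar.
by apply: IH => //; apply: uout.
Qed.

Lemma out_edge_setf x (Y : {fset V}) (b : C Y) (t : Y -> term C) (y : Y) s :
  out x s -> inv x <> x -> corollas T (Ordinary b) -> val y = inv x ->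
  (forall z : Y, z != y -> out (val z) (t z)) ->
  s = Mu (inv x) (Op b (setf t y (Var C (inv x)))).
Proof.
move=> xs ix Tb yx tout; apply: out_unique xs _; apply: out_edge => //.
- by rewrite -yx fsvalP.
- move=> z zx; have zy : z != y by apply/eqP => zy; apply: zx; rewrite zy.
  by rewrite setf_neq//; apply: tout.
- by move=> z zx; rewrite (_ : z = y) ?setf_eq//; apply: val_inj; rewrite /= zx.
Qed.

Lemma reach_first x z : reach T x z -> x = z \/ exists2 y, step T x y & reach T y z.
Proof.
elim=> [|u v uv _ [->|[y xy yu]]]; first by left.
  by right; exists v => //; apply: rtn1_refl.
by right; exists y => //; apply: rtn1_trans yu.
Qed.

Lemma reach_leg x z : inv x = x -> reach T x z -> z = x.
Proof. by move=> ix /reach_first[//|[y []]]. Qed.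

Lemma out_vars x s z : vars T x -> out x s -> z \in varsT s -> vars T z.
Proof.
move=> + xs; elim: xs => {x s} [x ix|x Y b t ix Tb xY tout IH tvar] xT /=.
  by rewrite inE => /eqP ->.
rewrite !inE => /orP[/eqP ->|/in_bigU[y zy]]; first exact: inv_vars.
case: (pselect (val y = inv x)) => yx; last first.
  by apply: IH yx _ zy; exists (Ordinary b); rewrite //= fsvalP.
by move: zy; rewrite tvar// inE => /eqP ->; apply: inv_vars.
Qed.

Section Tree.
Hypothesis tree : ordinary_tree T.

Lemma step_in_cor x (Y : {fset V}) (b : C Y) (y : V) :
  inv x <> x -> corollas T (Ordinary b) -> inv x \in Y -> y \in Y -> y <> inv x ->
  step T x y.
Proof. by move=> ix Tb xY yY yx; split=> //; exists (Ordinary b); rewrite //= xY. Qed.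

(** Linearity comes from the disjointness of branches. The argument [Var (inv x)] causes no clash,
    because the free variables of the other arguments are legs and [inv x] is not one. *)
Lemma out_lin x s : vars T x -> out x s ->
  linT s /\ forall z, z \in fvT s <-> reach T x z /\ inv z = z.
Proof.
move=> + xs; elim: xs => {x s} [x ix|x Y b t ix Tb xY tout IH tvar] xT /=.
  split=> // z; rewrite inE; split=> [/eqP ->|[/(reach_leg ix) -> //]].
  by split=> //; apply: rtn1_refl.
have bT (y : Y) : vars T (val y) by exists (Ordinary b); rewrite //= fsvalP.
have st (y : Y) : val y <> inv x -> step T x (val y).
  by apply: step_in_cor ix Tb xY _; apply: fsvalP.
have fv_t (y : Y) z : z \in fvT (t y) ->
    val y = inv x /\ z = inv x \/ reach T (val y) z /\ inv z = z.
  case: (pselect (val y = inv x)) => yx; last by move/(IH y yx (bT y)).2; right.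
  by rewrite tvar// inE => /eqP ->; left.
have ixfix : inv (inv x) <> inv x by rewrite invK; apply: nesym.
split; [split; [split|]|].
- move=> y; case: (pselect (val y = inv x)) => yx; first by rewrite tvar.
  exact: (IH y yx (bT y)).1.
- move=> y y' yy'; apply/fdisjointE => z /fv_t[[yx ->]|[yz iz]] /fv_t[[yx' zx]|[yz' iz']] //.
  + by case/eqP: yy'; apply: val_inj; rewrite /= yx.
  + by rewrite zx in iz.
  + case/eqP: yy'; apply: val_inj; apply: (reach_disjoint tree _ yz yz').
    by exists (Ordinary b); rewrite //= !fsvalP.
- by apply/in_bigU; exists [` xY]; rewrite tvar// inE.
move=> z; rewrite !inE; split.
  case/andP => zx /in_bigU[y]; case: (pselect (val y = inv x)) => yx.
    by rewrite tvar// inE (negbTE zx).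
  move/(IH y yx (bT y)).2 => [yz iz]; split=> //.
  exact: reach_trans (step_reach (st y yx)) yz.
case=> /reach_first[<- //|[y [_ yx xy] yz]] iz; apply/andP; split.
  by apply/eqP => zx; rewrite zx in iz.
have yY : y \in Y := co_mem Tb xY xy.
by apply/in_bigU; exists [` yY]; apply/(IH [` yY] yx (bT _)).2.
Qed.

Lemma out_exists x : vars T x -> exists s, out x s.
Proof.
have [ord _ _ _ _] := tree.
move=> xT; apply: (step_wf tree (P := fun x => exists s, out x s) xT) => {}x {}xT IH.
case: (pselect (inv x = x)) => ix; first by exists (Var C x); apply: out_leg.
have [K TK xK] := inv_vars xT; have := ord K TK.
case: K xK TK => [Y b /= xY Tb _|//].
have /choice[t tP] (y : Y) : exists s,
    (val y <> inv x -> out (val y) s) /\ (val y = inv x -> s = Var C (inv x)).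
  case: (pselect (val y = inv x)) => yx; first by exists (Var C (inv x)).
  have [s ys] := IH _ (step_in_cor ix Tb xY (fsvalP y) yx).
  by exists s.
by exists (Mu (inv x) (Op b t)); apply: out_edge => // y; [case: (tP y)|case: (tP y)].
Qed.

Lemma outs_exist (Y : {fset V}) (b : C Y) : corollas T (Ordinary b) ->
  exists t, forall y : Y, out (val y) (t y).
Proof.
move=> Tb; have /choice[t tP] (y : Y) : exists s, out (val y) s.
  by apply: out_exists; exists (Ordinary b); rewrite //= fsvalP.
by exists t.
Qed.

Lemma outs_lin (Y : {fset V}) (b : C Y) t : corollas T (Ordinary b) ->
  (forall y : Y, out (val y) (t y)) ->
  linC (Op b t) /\ forall z, z \in fvC (Op b t) <-> fv T z.
Proof.
move=> Tb tout.
have bT (y : Y) : vars T (val y) by exists (Ordinary b); rewrite //= fsvalP.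
have tlin y := out_lin (bT y) (tout y).
split.
  split=> [y|y y' yy']; first exact: (tlin y).1.
  apply/fdisjointE => z /(tlin y).2[yz _] /(tlin y').2[yz' _].
  case/eqP: yy'; apply: val_inj; apply: (reach_disjoint tree _ yz yz').
  by exists (Ordinary b); rewrite //= !fsvalP.
move=> z; split.
  by case/in_bigU => y /(tlin y).2[/reach_vars-/(_ (bT y)) zT iz].
case=> zT iz; have [[y yY yz]|[//]] := vars_cover tree Tb zT.
by apply/in_bigU; exists [` yY]; apply/(tlin _).2.
Qed.

Lemma outs_eq_adjacent (Y Z : {fset V}) (b : C Y) (c : C Z) t u :
  corollas T (Ordinary b) -> (forall y : Y, out (val y) (t y)) ->
  corollas T (Ordinary c) -> (forall z : Z, out (val z) (u z)) ->
  adjacent T (Ordinary b) (Ordinary c) -> eqC (Op b t) (Op c u).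
Proof.
move=> Tb tout Tc uout [_ [_ _ [x [/= xY ixZ ix _]]]].
have iix : inv (inv x) <> inv x by rewrite invK; apply: nesym.
pose y : Y := [` xY]; pose z : Z := [` ixZ].
have ty : t y = Mu (inv x) (Op c (setf u z (Var C (inv x)))).
  by apply: out_edge_setf (tout y) _ Tc _ _.
have uz : u z = Mu x (Op b (setf t y (Var C x))).
  have := @out_edge_setf (inv x) Y b t y _ (uout z) iix Tb.
  by rewrite invK; apply.
have [lt _] := outs_lin Tb tout; have [lu _] := outs_lin Tc uout.
have nfv (W : {fset V}) (d : C W) v (w' : W) r : corollas T (Ordinary d) ->
    (forall w : W, out (val w) (v w)) -> inv r <> r -> r \notin fvT (v w').
  move=> Td vout ir; apply/negP => /(out_lin _ (vout w')).2 [|_ //].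
  by exists (Ordinary d); rewrite //= fsvalP.
have P1 : eqC (Op b t) (Cut (Mu x (Op b (setf t y (Var C x)))) (t y)).
  by apply: eqC_plug => // y' _; apply: nfv Tb tout ix.
have P2 : eqC (Op c u)
    (Cut (Mu (inv x) (Op c (setf u z (Var C (inv x))))) (u z)).
  by apply: eqC_plug => // z' _; apply: nfv Tc uout iix.
(* Both commands are now cuts of the same two abstractions, in opposite order. *)
rewrite ty in P1; rewrite uz in P2; have [_ l1 _] := eqC_lin P1.
exact: eqC_trans P1 (eqC_trans (eqC_MU1 l1) (eqC_sym P2)).
Qed.

Lemma outs_eq (Y Z : {fset V}) (b : C Y) (c : C Z) t u :
  corollas T (Ordinary b) -> (forall y : Y, out (val y) (t y)) ->
  corollas T (Ordinary c) -> (forall z : Z, out (val z) (u z)) ->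
  eqC (Op b t) (Op c u).
Proof.
have [ord conn _ _ _] := tree.
move=> Tb tout Tc uout.
have [K KE] : exists K, K = Ordinary c by exists (Ordinary c).
have := clos_rt_rtn1 _ _ _ _ (conn _ _ Tb Tc); rewrite -KE => bK.
elim: bK Z c u Tc uout KE => [|{}K L KL _ IH] Z c u Tc uout E.
  have YZ : Y = Z := congr1 (@fv_cor V C) E.
  case: Z / YZ c u Tc uout E => c u Tc uout /Ordinary_inj <-.
  suff -> : u = t by apply: eqC_refl; case: (outs_lin Tb tout).
  by apply/funext => y; apply: out_unique (uout y) (tout y).
have TK : corollas T K by case: KL => e [].
case: K TK KL IH (ord K TK) => [W d Td KL IH _|//].
have [v vout] := outs_exist Td.
apply: eqC_trans (IH _ _ _ Td vout erefl) _.
by apply: outs_eq_adjacent => //; rewrite -E.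
Qed.

End Tree.

Section Unrooted.
Hypothesis tree : unrooted_tree T.

Lemma exceptional_wire (e : {fset V}) (e2 : #|` e| == 2) :
  corollas T (Special C e2) ->
  corollas T = [set Special C e2]%classic /\ forall x, inv x = x.
Proof.
move=> Te; case: tree => [[/(_ _ Te)//]|[[e' [e2' TE]] iT]].
by split=> //; move: Te; rewrite TE => <-.
Qed.

Lemma exceptional_ordinary (Y : {fset V}) (b : C Y) :
  corollas T (Ordinary b) -> ordinary_tree T.
Proof. by move=> Tb; case: tree => [//|[[e [e2 TE]] _]]; rewrite TE in Tb. Qed.

Lemma reads_lin c : reads c -> linC c /\ forall z, z \in fvC c <-> fv T z.
Proof.
case=> [Y b t Tb tout|e e2 x y Te exy ix iy].
  by apply: outs_lin => //; apply: exceptional_ordinary Tb.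
have [TE iT] := exceptional_wire Te; split.
  split=> //=; rewrite fdisjoint1X inE; apply/eqP => xy.
  by move: e2 {Te TE}; rewrite exy xy cardfs2 eqxx.
move=> z; rewrite /= /fv /vars /vars_of TE -exy; split.
  by move=> ze; split; [exists (Special C e2)|].
by case=> -[K -> ze].
Qed.

Lemma reads_exist : exists c, reads c.
Proof.
case: tree => [otree|[[e [e2 TE]] iT]].
  have [ord _ _ _ _] := otree; have [K TK] := corollas_nonempty T.
  have := ord K TK; case: K TK => // Y b Tb _.
  by have [t tout] := outs_exist otree Tb; exists (Op b t); apply: reads_op.
have [x [y exy]] : exists x y, e = [fset x; y].
  have /fset0Pn[x xe] : e != fset0 by rewrite -cardfs_gt0 (eqP e2).
  have /cardfs1P[y yE] : #|` e `\ x| == 1.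
    by rewrite -(eqn_add2l (x \in e)) -cardfsD1 xe (eqP e2).
  by exists x, y; rewrite -(fsetD1K xe) yE.
exists (Cut (Var C x) (Var C y)); apply: (@reads_wire e e2) => //.
by rewrite TE.
Qed.

Lemma reads_eq c d : reads c -> reads d -> eqC c d.
Proof.
case=> [Y b t Tb tout|e e2 x y Te exy ix iy] rd.
  have otree := exceptional_ordinary Tb.
  case: rd => [Z d' u Tc uout|e e2 x y Te exy ix iy]; first exact: outs_eq.
  by have [/(_ _ Te)] := otree.
have cl := (reads_lin (reads_wire Te exy ix iy)).1.
have [TE _] := exceptional_wire Te.
case: rd => [Z d' u|e' e2' x' y']; rewrite TE => // -[ee'] E _ _.
have xy' : x' != y'.
  by apply: contraTneq e2' => xy'; rewrite E xy' cardfs2 eqxx.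
move: (etrans (etrans (esym E) ee') exy) => /fsetP {}E.
have /orP[/eqP xx'|/eqP yx'] : (x' == x) || (x' == y).
- by have := E x'; rewrite !inE eqxx => <-.
- suff -> : y' = y by rewrite xx'; apply: eqC_refl.
  by have := E y'; rewrite !inE -xx' eqxx orbT eq_sym (negbTE xy') => /esym/eqP.
- suff -> : y' = x by rewrite yx'; apply: eqC_MU1.
  by have := E y'; rewrite !inE -yx' eqxx orbT [_ == x']eq_sym (negbTE xy') orbF => /esym/eqP.
Qed.

End Unrooted.
End Reading.

(** The branch at [x] involves only the half-edges reached from [x] and the corollas beyond them, so
    agreement there suffices. It serves to move branches of a tree unchanged into a graft. *)
Lemma out_transfer (V : choiceType) (C : bijFunctor V) (T T' : graph C) x s :
  (forall z, reach T x z -> inv T' z = inv T z /\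
     forall K, corollas T K -> inv T z <> z -> inv T z \in fv_cor K ->
       corollas T' K) ->
  out T x s -> out T' x s.
Proof.
move=> + xs; elim: xs => {x s} [x ix|x Y b t ix Tb xY tout IH tvar] TT'.
  by apply: out_leg; have [-> _] := TT' x (rtn1_refl _ _ _).
have [ix' Tx] := TT' x (rtn1_refl _ _ _).
rewrite -ix'; apply: out_edge; rewrite ?ix' //; first exact: Tx.
move=> y yx; apply: IH => // z yz; apply: TT'.
apply: reach_trans yz; apply: step_reach.
exact: step_in_cor ix Tb xY (fsvalP y) yx.
Qed.

(** * Renaming *)

Section RenameCor.
Context (V : choiceType) (C : bijFunctor V).

Lemma fbij_eq (X Y : {fset V}) (sigma tau : fbij X Y) : sigma =1 tau -> sigma = tau.
Proof.
case: sigma tau => f fb [g gb] /= /funext fg; case: g / fg gb => gb.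
by congr FBij; apply: Prop_irrelevance.
Qed.

Lemma fbij_inv (X Y : {fset V}) (sigma : fbij X Y) :
  exists tau : fbij Y X, cancel sigma tau /\ cancel tau sigma.
Proof.
by case: (fbij_bij sigma) => g sK gK; exists (FBij (Bijective gK sK)).
Qed.

Lemma act_cancel (X Y : {fset V}) (sigma : fbij X Y) (tau : fbij Y X) (a : C Y) :
  cancel tau sigma -> act tau (act sigma a) = a.
Proof.
move=> tK; rewrite -act_comp -[RHS]act_id; congr (act _ a).
exact: fbij_eq.
Qed.

Lemma rename_ordinaryE f (X : {fset V}) (a : C X) L : rename_cor f (Ordinary a) L ->
  exists (Z : {fset V}) (tau : fbij Z X),
    (forall z, f (val (tau z)) = val z) /\ L = Ordinary (act tau a).
Proof.
have [K KE] : exists K, K = Ordinary a by exists (Ordinary a).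
rewrite -KE => KL; case: KL KE => // Y Z b tau ft E.
have XY : Y = X := congr1 (@fv_cor V C) E.
case: X / XY a E => a /Ordinary_inj <-; by exists Z, tau.
Qed.

Lemma rename_specialE f (e : {fset V}) (e2 : #|` e| == 2) (L : corolla C) :
  rename_cor f (Special C e2) L ->
  exists2 e2' : #|` [fset f x | x in e]| == 2, True & L = Special C e2'.
Proof.
have [K KE] : exists K, K = Special C e2 by exists (Special C e2).
rewrite -KE => KL; case: KL KE => // e0 e' e02 e2' E [ee].
by move: e2'; rewrite E ee => e2'; exists e2'.
Qed.

Lemma rename_fv f (K L : corolla C) y : rename_cor f K L ->
  y \in fv_cor L <-> exists2 x, x \in fv_cor K & y = f x.
Proof.
case=> [X Z a tau ft|e e' e2 e2' ee'] /=; last rewrite {}ee'.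
  split=> [yZ|[x xX ->]].
    by exists (val (tau [` yZ])); rewrite ?fsvalP// ft.
  have [sg [_ sK]] := fbij_inv tau.
  by have := ft (sg [` xX]); rewrite sK /= => ->; apply: fsvalP.
by split=> [/imfsetP[x xe ->]|[x xe ->]]; [exists x|apply: in_imfset].
Qed.

Lemma rename_inv f g (K L : corolla C) :
  (forall x, x \in fv_cor K -> g (f x) = x) -> rename_cor f K L ->
  rename_cor g L K.
Proof.
move=> + KL; case: KL => [X Z a tau ft|e e' e2 e2' ee'] /= gK.
  have [sg [tK sK]] := fbij_inv tau.
  rewrite -{2}(act_cancel a sK); apply: rename_ordinary => x.
  by rewrite -ft sK gK//= fsvalP.
apply: rename_special; apply/fsetP => x; apply/idP/imfsetP => [xe|[y]].
  by exists (f x); rewrite ?gK//= ee' in_imfset.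
by rewrite /= ee' => /imfsetP[z /= ze ->] ->; rewrite gK.
Qed.

Lemma rename_exists f g (K : corolla C) :
  (forall x, x \in fv_cor K -> g (f x) = x) -> exists L, rename_cor f K L.
Proof.
case: K => [X a|e e2] /= fK.
  pose Z := [fset f x | x in X].
  have fZ (x : X) : f (val x) \in Z by rewrite in_imfset//= fsvalP.
  have gX (z : Z) : g (val z) \in X.
    by case/imfsetP: (fsvalP z) => x /= xX ->; rewrite fK.
  have gZ (z : Z) : f (g (val z)) = val z.
    by case/imfsetP: (fsvalP z) => x /= xX ->; rewrite fK.
  have K1 : cancel (fun z : Z => [` gX z]) (fun x : X => [` fZ x]).
    by move=> z; apply: val_inj; rewrite /= gZ.
  have K2 : cancel (fun x : X => [` fZ x]) (fun z : Z => [` gX z]).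
    by move=> x; apply: val_inj; rewrite /= fK// fsvalP.
  exists (Ordinary (act (FBij (Bijective K1 K2)) a)).
  by apply: rename_ordinary => z /=; apply: gZ.
have e2' : #|` [fset f x | x in e]| == 2.
  by rewrite card_in_imfset//= => x y xe ye /(congr1 g); rewrite !fK.
by exists (Special C e2'); apply: rename_special.
Qed.

Lemma rename_unique f (K L M : corolla C) :
  (forall x y, x \in fv_cor K -> y \in fv_cor K -> f x = f y -> x = y) ->
  rename_cor f K L -> rename_cor f K M -> L = M.
Proof.
move=> finj KL KM.
have {KL} [] := (KL, fun y => rename_fv y KL).
case: K finj KM => [X a|e e2] finj KM.
  move=> /rename_ordinaryE[Z [tau [ft LE]]] Lfv; rewrite {L}LE /= in Lfv *.
  have := fun y => rename_fv y KM.
  have [W [sg [fs ->]]] := rename_ordinaryE KM => /= Mfv.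
  have ZW : Z = W.
    by apply/fsetP => y; apply/idP/idP => [/Lfv/Mfv|/Mfv/Lfv].
  case: W / ZW sg fs {Mfv KM} => sg fs; congr (Ordinary (act _ a)).
  apply: fbij_eq => z; apply: val_inj; apply: finj; rewrite ?fsvalP//.
  by rewrite ft fs.
move=> /rename_specialE[e2' _ ->] _.
have [e2'' _ ->] := rename_specialE KM; congr Special; exact: Prop_irrelevance.
Qed.

Lemma rename_comp f g (K L M : corolla C) : rename_cor f K L ->
  rename_cor g L M -> rename_cor (g \o f) K M.
Proof.
case=> [X Z a tau ft|e e' e2 e2' ee'].
  case/rename_ordinaryE => W [sg [gs ->]]; rewrite -act_comp.
  by apply: rename_ordinary => w /=; rewrite ft gs.
case/rename_specialE => e2'' _ ->; apply: rename_special.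
apply/fsetP => z; rewrite ee'; apply/imfsetP/imfsetP => /= [[_ /imfsetP[y ye ->] ->]|[y ye ->]].
  by exists y.
by exists (f y); rewrite // in_imfset.
Qed.

Lemma rename_eq f g (K L : corolla C) : (forall x, x \in fv_cor K -> f x = g x) ->
  rename_cor f K L -> rename_cor g K L.
Proof.
move=> + KL; case: KL => [X Z a tau ft|e e' e2 e2' ee'] /= fg.
  by apply: rename_ordinary => z; rewrite -fg ?fsvalP.
by apply: rename_special; rewrite ee'; apply: eq_in_imfset.
Qed.

(** The bijection [tau] inverts [f] on the corolla. This is where morphisms of trees get their local
    injectivity. *)
Lemma rename_inj f (K L : corolla C) x y : is_ordinary K -> rename_cor f K L ->
  x \in fv_cor K -> y \in fv_cor K -> f x = f y -> x = y.
Proof.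
case: K => // X a _ /rename_ordinaryE[Z [tau [ft _]]] /= xX yX fxy.
have [sg [_ sK]] := fbij_inv tau.
have ftx := ft (sg [` xX]); have fty := ft (sg [` yX]); rewrite !sK /= in ftx fty.
suff E : [` xX] = [` yX] by rewrite -[x]/(val [` xX]) E.
by rewrite -[LHS]sK -[RHS]sK; congr (tau _); apply: val_inj; rewrite /= -ftx -fty.
Qed.

End RenameCor.

(** * Transport of readings along alpha-conversion *)

Section Transfer.
Context (V : choiceType) (C : bijFunctor V).
Hypothesis V_infinite : infinite_set [set: V]%classic.

(** One direction of a renaming, stated so that its inverse has the same form and one proof
    transports readings both ways. Freshness is relative to the source tree because its half-edges
    are the names used in its readings; this yields the side condition of (MU3). *)
Record fresh_morphism (T T' : graph C) (f g : V -> V) : Prop := FreshMorphism {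
  fm_vars : forall x, vars T x -> vars T' (f x);
  fm_cancel : forall x, vars T x -> g (f x) = x;
  fm_cor : forall K, corollas T K -> exists2 L, corollas T' L & rename_cor f K L;
  fm_inv : forall x, vars T x -> inv T' (f x) = f (inv T x);
  fm_fix : forall x, vars T x -> inv T x = x -> f x = x;
  fm_fresh : forall x, vars T x -> f x <> x -> ~ vars T (f x) }.

Lemma renaming_morphisms (T T' : graph C) : renaming T T' ->
  exists f g, fresh_morphism T T' f g /\ fresh_morphism T' T g f.
Proof.
move=> [f [ffix ffresh finj TE finv]].
have /choice[g gP] (y : V) : exists x, forall x', vars T x' -> f x' = y -> x = x'.
  case: (pselect (exists2 x, vars T x & f x = y)) => [[x xT xy]|nx].
    by exists x => x' xT' xy'; apply: finj => //; rewrite xy.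
  by exists y => x' xT' xy'; case: nx; exists x'.
have fK x : vars T x -> g (f x) = x by move=> xT; apply: gP.
have fcor K : corollas T K -> exists2 L, corollas T' L & rename_cor f K L.
  move=> TK; suff [L KL] : exists L, rename_cor f K L.
    by exists L => //; rewrite TE; exists K.
  have fK' x : x \in fv_cor K -> g (f x) = x by move=> xK; apply: fK; exists K.
  exact: rename_exists fK'.
have T'vars y : vars T' y -> exists2 x, vars T x & y = f x.
  case=> L; rewrite TE => -[K TK KL] /(rename_fv _ KL)[x xK ->].
  by exists x => //; exists K.
exists f, g; split; split=> //.
- move=> x [K TK xK]; have [L TL KL] := fcor K TK; exists L => //.
  by apply/(rename_fv _ KL); exists x.
- by move=> x xT ix; apply: ffix.
- by move=> y /T'vars[x xT ->]; rewrite fK.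
- by move=> y /T'vars[x xT ->]; rewrite fK.
- move=> L; rewrite TE => -[K TK KL]; exists K => //.
  by apply: rename_inv KL => x xK; apply: fK; exists K.
- by move=> y /T'vars[x xT ->]; rewrite finv// !fK//; apply: inv_vars.
- move=> y /T'vars[x xT ->]; rewrite finv// fK// => ix; apply/esym/ffix.
  by split=> //; apply: finj => //; apply: inv_vars.
- move=> y /T'vars[x xT ->]; rewrite fK// => xfx /T'vars[x' xT' xx'].
  case: (pselect (f x' = x')) => fx'; last by case: (ffresh x'); rewrite // -xx'.
  by have E : x = x' by [rewrite xx' fx']; apply: xfx; rewrite {1}xx' E.
Qed.

Section Morphism.
Variables (T T' : graph C) (f g : V -> V).
Hypothesis fm : fresh_morphism T T' f g.

Lemma fm_inj x y : vars T x -> vars T y -> f x = f y -> x = y.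
Proof. by move=> xT yT /(congr1 g); rewrite !(fm_cancel fm). Qed.

Lemma out_rename x s : vars T x -> out T x s -> linT s ->
  exists2 s', out T' (f x) s' & eqT s s'.
Proof.
move=> + xs; elim: xs => {x s} [x ix|x Y b t ix Tb xY tout IH tvar] xT ls.
  rewrite (fm_fix fm)//; exists (Var C x); last exact: eqT_refl.
  by apply: out_leg; rewrite -{1}(fm_fix fm xT)// (fm_inv fm)// ix (fm_fix fm).
have ixT := inv_vars xT.
have bT (y : Y) : vars T (val y) by exists (Ordinary b); rewrite //= fsvalP.
pose q := inv T x; pose y0 : Y := [` xY].
have y0P (y : Y) : y != y0 -> val y <> q.
  by move=> yy0 yq; case/eqP: yy0; apply: val_inj.
have [lt qt] := ls; have [lty dt] := lt.
have tE : t = setf t y0 (Var C q).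
  by apply/funext => y; rewrite /setf; case: eqVneq => // ->; apply: tvar.
have qfresh (y : Y) : y != y0 -> q \notin fvT (t y).
  move=> yy0; apply/negP => qy; apply: ((fdisjointE _ _).1 (dt _ _ yy0) q) => //.
  by rewrite tvar//= inE.
(* The binder is renamed by (MU3), the branches are then renamed by induction, and (MU4) finally
   reindexes the operation along [tau]. *)
have step1 : eqT (Mu q (Op b t)) (Mu (f q) (Op b (setf t y0 (Var C (f q))))).
  case: (pselect (f q = q)) => fq; first by rewrite fq -tE; apply: eqT_refl.
  rewrite -(subst1_setf _ _ qfresh) -tE; apply: eqT_MU3 => //.
  apply/negP; rewrite inE => /andP[_ fqv]; apply: (fm_fresh fm ixT fq).
  apply: (out_vars xT (out_edge ix Tb xY tout tvar)).
  by rewrite /= inE fqv orbT.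
have [_ [lt1 _] _] := eqT_lin step1.
have /choice[u uP] (y : Y) : exists s', y != y0 ->
    out T' (f (val y)) s' /\ eqT (t y) s'.
  case: (eqVneq y y0) => [_|/y0P yq]; first by exists (Var C q).
  by have [s' ? ?] := IH y yq (bT y) (lty y); exists s'.
have step2 : eqC (Op b (setf t y0 (Var C (f q)))) (Op b (setf u y0 (Var C (f q)))).
  apply: eqC_op; last exact: lt1.2.
  move=> y; rewrite /setf; case: eqVneq => [_|/uP[]//]; exact: eqT_refl.
have [L TL /rename_ordinaryE[Z [tau [ft LE]]]] := fm_cor fm Tb.
have [_ lu _] := eqC_lin step2.
have step3 := eqC_MU4 tau lu.
have [sg [_ sK]] := fbij_inv tau.
have fqZ : f q \in Z.
  by have := ft (sg y0); rewrite sK /= -/q => ->; apply: fsvalP.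
exists (Mu (f q) (Op (act tau b) (fun z => setf u y0 (Var C (f q)) (tau z)))).
  rewrite -(fm_inv fm xT) in fqZ *; apply: out_edge => //.
  - by rewrite (fm_inv fm xT) => /(fm_inj ixT xT).
  - by rewrite -LE.
  - move=> z; rewrite (fm_inv fm xT) -ft => zq.
    have zy0 : tau z != y0 by apply/eqP => zy0; apply: zq; rewrite zy0.
    by rewrite setf_neq//; case: (uP _ zy0).
  - move=> z; rewrite (fm_inv fm xT) -ft => zq.
    rewrite (_ : tau z = y0) ?setf_eq//; apply: val_inj => /=.
    exact: fm_inj zq.
apply: eqT_trans step1 _; apply: eqT_mu; last exact: fv_setf.
exact: eqC_trans step2 step3.
Qed.

Lemma reads_rename c : reads T c -> linC c -> exists2 c', reads T' c' & eqC c c'.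
Proof.
case=> [Y b t Tb tout|e e2 x y Te exy ix iy] lc.
  have [lt dt] := lc.
  have /choice[u uP] (y : Y) : exists s', out T' (f (val y)) s' /\ eqT (t y) s'.
    have bT : vars T (val y) by exists (Ordinary b); rewrite //= fsvalP.
    by have [s' ? ?] := out_rename bT (tout y) (lt y); exists s'.
  have step1 : eqC (Op b t) (Op b u).
    by apply: eqC_op => // y; case: (uP y).
  have [_ lu _] := eqC_lin step1.
  have [L TL /rename_ordinaryE[Z [tau [ft LE]]]] := fm_cor fm Tb.
  exists (Op (act tau b) (fun z => u (tau z))); last first.
    exact: eqC_trans step1 (eqC_MU4 tau lu).
  apply: reads_op; first by rewrite -LE.
  by move=> z; rewrite -ft; case: (uP (tau z)).
exists (Cut (Var C x) (Var C y)); last exact: eqC_refl.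
have [L TL /rename_specialE[e2' _ LE]] := fm_cor fm Te.
have eT z : z \in e -> vars T z by exists (Special C e2).
have xT : vars T x by apply: eT; rewrite exy !inE eqxx.
have yT : vars T y by apply: eT; rewrite exy !inE eqxx orbT.
have [fx fy] := (fm_fix fm xT ix, fm_fix fm yT iy).
have leg z : f z = z -> vars T z -> inv T z = z -> inv T' z = z.
  by move=> fz zT iz; rewrite -{1}fz (fm_inv fm zT) iz.
apply: (reads_wire (e2 := e2')); [by rewrite -LE| |exact: leg|exact: leg].
apply/fsetP => z; rewrite exy; apply/imfsetP/idP => /=.
  by case=> w + ->; rewrite !inE => /orP[] /eqP ->; rewrite ?fx ?fy eqxx ?orbT.
by rewrite !inE => /orP[] /eqP ->; [exists x|exists y]; rewrite // !inE eqxx ?orbT.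
Qed.

End Morphism.

(** This relation induces the bijection. It is closed under =_mu by construction and under
    alpha-equivalence by [realizes_alpha]. *)
Definition realizes (T : graph C) (c : command C) := exists2 d, reads T d & eqC c d.

Lemma realizes_renaming (T T' : graph C) c : renaming T T' ->
  realizes T c <-> realizes T' c.
Proof.
move=> /renaming_morphisms[f [g [fm gm]]].
by split=> -[d rd cd]; have [_ ld _] := eqC_lin cd;
  [have [d' rd' dd'] := reads_rename fm rd ld|have [d' rd' dd'] := reads_rename gm rd ld];
  exists d' => //; apply: eqC_trans cd dd'.
Qed.

Lemma realizes_alpha (T T' : graph C) c : alpha_graph T T' ->
  realizes T c <-> realizes T' c.
Proof.
elim=> [T1 T2 r12|T1|T1 T2 _ r12|T1 T2 T3 _ r12 _ r23].
- exact: realizes_renaming r12.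
- exact: iff_refl.
- exact: iff_sym r12.
- exact: iff_trans r12 r23.
Qed.

End Transfer.

(** * From equal commands to isomorphic trees *)

Section GraphModel.
Context (V : choiceType) (C : bijFunctor V) (T : graph C).

(* A leg [x] is turned into an edge between the port [(x, false)] and an outer
   end [(x, true)]; otherwise an edge could be folded onto a leg. *)
Definition flip (e : V * bool) : V * bool :=
  if inv T e.1 == e.1 then (e.1, ~~ e.2) else (inv T e.1, e.2).

Lemma flipK : involutive flip.
Proof.
case=> x b; rewrite /flip /=; case: (eqVneq (inv T x) x) => [ix|ix] /=.
  by rewrite ix eqxx negbK.
by rewrite invK eq_sym (negbTE ix).
Qed.

(** The map [h] merely extends [g] from [X] to [V], as [rename_cor] requires. Asking for a corolla
    only up to renaming is what makes the interpretation respect (MU4). *)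
Definition at_corolla (X : {fset V}) (a : C X) (g : X -> V * bool) :=
  exists2 L, corollas T L & exists2 h : V -> V,
    rename_cor h (Ordinary a) L & forall x, g x = (h (val x), false).

Lemma extend_fun (X : {fset V}) (g : X -> V) :
  exists h : V -> V, forall x, h (val x) = g x.
Proof.
exists (fun v => if insub v is Some x then g x else v) => x.
by rewrite valK.
Qed.

Lemma at_corolla_act_imp (X Y : {fset V}) (sigma : fbij Y X) (a : C X) g :
  at_corolla a g -> at_corolla (act sigma a) (fun y => g (sigma y)).
Proof.
case=> L TL [h /rename_ordinaryE[Z [tau [ht LE]]] gh]; exists L => //.
have [sg [_ sK]] := fbij_inv sigma.
have [h' h'P] := extend_fun (fun y => h (val (sigma y))).
exists h' => [|y]; last by rewrite gh h'P.
have -> : L = Ordinary (act (fbij_comp sg tau) (act sigma a)).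
  rewrite LE -act_comp; congr (Ordinary (act _ a)).
  by apply: fbij_eq => z /=; rewrite sK.
by apply: rename_ordinary => z; rewrite /= h'P sK.
Qed.

Lemma at_corolla_act (X Y : {fset V}) (sigma : fbij Y X) (a : C X) g :
  at_corolla a g <-> at_corolla (act sigma a) (fun y => g (sigma y)).
Proof.
split; first exact: at_corolla_act_imp.
have [sg [_ sK]] := fbij_inv sigma.
move/(at_corolla_act_imp sg); rewrite act_cancel//.
by rewrite (_ : (fun y => g (sigma (sg y))) = g)//; apply/funext => x; rewrite sK.
Qed.

Definition port (x : V) : V * bool := (x, false).

(** The tautological valuation works: every half-edge denotes its own port. *)
Lemma out_den x s : out T x s -> denT flip at_corolla s port (port x).
Proof.
elim=> {x s} [//|x Y b t ix Tb xY tout IH tvar] /=.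
have fx : flip (port x) = port (inv T x) by rewrite /flip /=; case: eqP.
exists (fun y => port (val y)); split.
  exists (Ordinary b) => //; exists id => //.
  by rewrite -{2}[b]act_id; apply: rename_ordinary.
move=> y; case: (pselect (val y = inv T x)) => yx.
  by rewrite tvar//= /env_upd eqxx fx yx.
apply: (den_coincidence _ _).2 (IH y yx) => z zy; rewrite /env_upd fx.
by case: eqP => // ->.
Qed.

Lemma outs_den (Y : {fset V}) (b : C Y) t : corollas T (Ordinary b) ->
  (forall y : Y, out T (val y) (t y)) ->
  denC flip at_corolla (Op b t) port.
Proof.
move=> Tb tout; exists (fun y => port (val y)); split=> [|y]; last exact: out_den.
exists (Ordinary b) => //; exists id => //.
by rewrite -{2}[b]act_id; apply: rename_ordinary.
Qed.

End GraphModel.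

(** * Morphisms of trees obtained from a satisfied reading *)

Section Morphism.
Context (V : choiceType) (C : bijFunctor V).
Hypothesis V_infinite : infinite_set [set: V]%classic.
Variables (T T' : graph C).
Hypotheses (tree : ordinary_tree T) (tree' : ordinary_tree T').
Hypothesis fvE : forall x, fv T x <-> fv T' x.

Let den := denT (flip T') (at_corolla T').

(** The half-edge [x] of [T] may be sent to [v], as far as the branch beyond [x] is concerned.
    Several [v] can qualify, so a morphism has to be built by coherent choices. *)
Definition compat x v := exists2 s, out T x s & den s (@port V) (port v).

Lemma compat_leg x v : inv T x = x -> compat x v -> v = x.
Proof.
by move=> ix [s xs]; case: xs ix => [y iy _ []//|y Y b t iy _ _ _ _ /iy].
Qed.

Definition lifts (K : corolla C) (h : V -> V) (P : V -> Prop) :=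
  (exists2 L, corollas T' L & rename_cor h K L) /\
  (forall y, y \in fv_cor K -> P y -> compat y (h y)).

Lemma compat_edge x v : vars T x -> inv T x <> x -> compat x v ->
  exists h, [/\ inv T' v <> v, h (inv T x) = inv T' v &
    forall K, corollas T K -> inv T x \in fv_cor K ->
      lifts K h (fun y => y <> inv T x)].
Proof.
move=> xT + [s xs]; case: xs xT => [y iy _ /(_ iy)//|{}x Y b t ix Tb xY tout tvar].
move=> xT _ /= [g [[L TL [h bL gh]] tg]]; exists h.
have := tg [` xY]; rewrite tvar//= gh /env_upd eqxx /flip /=.
(* If [v] were a leg, crossing it would lead to an outer end, and [at_corolla] only gives ports. *)
case: (eqVneq (inv T' v) v) => // iv [hx]; split=> //; first by apply/eqP.
move=> K TK xK; have <- := corollas_eq Tb TK xY xK.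
split=> [|y yY yx]; first by exists L.
exists (t [` yY]); first exact: (tout [` yY]).
have := tg [` yY]; rewrite gh; apply: (den_coincidence _ _).2 => z zy.
(* The environments differ only at [inv T x], which is not free in the branch at [y]: its free
   variables are legs. *)
rewrite /env_upd; case: eqP => // zx; exfalso.
have yT : vars T y by exists (Ordinary b).
have /= [_ /(_ z)[/(_ zy)[_ iz] _]] := out_lin tree yT (tout [` yY] yx).
by apply: ix; move: iz; rewrite zx invK => /esym.
Qed.

Section Root.
Variables (Y0 : {fset V}) (b0 : C Y0) (t0 : Y0 -> term C).
Hypothesis Tb0 : corollas T (Ordinary b0).
Hypothesis t0_out : forall y : Y0, out T (val y) (t0 y).
Hypothesis den0 : denC (flip T') (at_corolla T') (Op b0 t0) (@port V).

Let K0 : corolla C := Ordinary b0.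

Lemma root_lift : exists h, lifts K0 h (fun=> True).
Proof.
have [g [[L TL [h bL gh]] tg]] := den0; exists h; split; first by exists L.
move=> y yY _; exists (t0 [` yY]); first exact: (t0_out [` yY]).
by have := tg [` yY]; rewrite gh.
Qed.

(** The function [ch] fixes once and for all how to continue beyond each half-edge with a given
    image, and [F n x v] propagates images along walks of [n] steps from the root. Uniqueness of
    predecessors makes [F] functional. *)
Lemma exists_morphism : exists f : V -> V,
  [/\ forall K, corollas T K -> exists2 L, corollas T' L & rename_cor f K L,
      forall x, vars T x -> inv T' (f x) = f (inv T x),
      forall x, vars T x -> inv T x <> x -> inv T' (f x) <> f x &
      forall x, vars T x -> inv T x = x -> f x = x].
Proof.
have [h0 [[L0 TL0 h0L] h0P]] := root_lift.
have /choice[ch chP] (p : V * V) : exists h, vars T p.1 -> inv T p.1 <> p.1 ->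
    compat p.1 p.2 ->
    [/\ inv T' p.2 <> p.2, h (inv T p.1) = inv T' p.2 &
    forall K, corollas T K -> inv T p.1 \in fv_cor K ->
      lifts K h (fun y => y <> inv T p.1)].
  case: (pselect [/\ vars T p.1, inv T p.1 <> p.1 & compat p.1 p.2]) => [[xT ix xv]|np].
    by have [h hP] := compat_edge xT ix xv; exists h.
  by exists id => *; case: np.
pose F := fix F (n : nat) (x v : V) : Prop :=
  if n is m.+1 then exists y w, [/\ F m y w, step T y x & v = ch (y, w) x]
  else x \in fv_cor K0 /\ v = h0 x.
have F_compat n x v : F n x v -> rreach T K0 x /\ compat x v.
  elim: n x v => [|n IH] x v /=.
    by case=> xK ->; split; [apply: rreach_root|apply: h0P].
  case=> y [w [/IH[yr yw] yx ->]]; split; first exact: rreach_step yr yx.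
  have [iy xy co_yx] := yx; have yT := rreach_vars Tb0 yr.
  have [_ _ yl] := chP (y, w) yT iy yw; case: co_yx => K TK /andP[yK xK].
  by have [_] := yl K TK yK; apply.
have F_unique n m x v w : F n x v -> F m x w -> v = w.
  elim: n m x v w => [|n IH] [|m] x v w /=.
  - by case=> _ -> [_ ->].
  - case=> xK _ [y [u [/F_compat[yr _] yx _]]].
    by case/negP: (rreach_step_root tree Tb0 yr yx).
  - case=> y [u [/F_compat[yr _] yx _]] [xK _].
    by case/negP: (rreach_step_root tree Tb0 yr yx).
  - case=> y [u [yu yx ->]] [y' [u' [yu' yx' ->]]].
    have [yr _] := F_compat _ _ _ yu; have [yr' _] := F_compat _ _ _ yu'.
    have E := rreach_pred tree Tb0 yr yr' yx yx'; rewrite -E in yu' *.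
    by rewrite (IH _ _ _ _ yu yu').
have F_total x : rreach T K0 x -> exists n v, F n x v.
  case=> y yK; elim=> [|u v uv _ [n [w uw]]]; first by exists 0, (h0 y).
  by exists n.+1, (ch (u, w) v), u, w.
(* [F] covers the half-edges that point away from the root; one that points back receives the
   opposite of the image of its other half. *)
have /choice[f fP] (x : V) : exists v,
    (forall n w, F n x w -> v = w) /\
    (~ rreach T K0 x -> forall n w, F n (inv T x) w -> v = inv T' w).
  case: (pselect (rreach T K0 x)) => [xr|nx].
    have [n [v xv]] := F_total _ xr; exists v; split=> // m w.
    exact: F_unique xv.
  case: (pselect (rreach T K0 (inv T x))) => [/F_total[n [v xv]]|nix].
    exists (inv T' v); split=> [m w /F_compat[]//|_ m w xw].
    by rewrite (F_unique _ _ _ _ _ xv xw).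
  by exists x; split=> [m w /F_compat[]//|_ m w /F_compat[]].
have f_out n x v : F n x v -> f x = v by case: (fP x) => + _; apply.
have f_in n x v : F n x v -> inv T x <> x -> f (inv T x) = inv T' v.
  move=> xv ix; have [xr _] := F_compat _ _ _ xv; case: (fP (inv T x)) => _; apply.
    exact: rreach_inv xr ix.
  by rewrite invK; apply: xv.
have f_edge n x v : F n x v -> inv T x <> x ->
    [/\ inv T' v <> v, ch (x, v) (inv T x) = inv T' v &
    forall K, corollas T K -> inv T x \in fv_cor K ->
      lifts K (ch (x, v)) (fun y => y <> inv T x)].
  move=> xv ix; have [xr xc] := F_compat _ _ _ xv.
  by apply: (chP (x, v)) => //; exact: (rreach_vars Tb0 xr).
have f_leg x : vars T x -> inv T x = x -> f x = x.
  move=> xT ix; have [/F_total[n [v xv]]|[//]] := vars_cover tree Tb0 xT.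
  by rewrite (f_out _ _ _ xv); apply: compat_leg (F_compat _ _ _ xv).2.
exists f; split=> //.
- move=> K TK; have [KE|[x xr [ix xK]]] := rreach_cover tree Tb0 TK.
    exists L0 => //; rewrite KE; apply: rename_eq h0L => x xK.
    exact/esym/(f_out 0).
  have [n [v xv]] := F_total _ xr; have [iv chx xl] := f_edge _ _ _ xv ix.
  have [[L TL KL] _] := xl K TK xK; exists L => //.
  apply: rename_eq KL => y yK; case: (pselect (y = inv T x)) => [->|yx].
    by rewrite (f_in _ _ _ xv).
  apply/esym/(f_out n.+1); exists x, v; split=> //; split=> //.
  by exists K; rewrite // xK.
- move=> x xT; have [xr|[ix xr]] := vars_cover tree Tb0 xT.
    case: (pselect (inv T x = x)) => ix.
      by rewrite ix f_leg//; have [_] := (fvE x).1 (conj xT ix).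
    have [n [v xv]] := F_total _ xr.
    by rewrite (f_in _ _ _ xv)// (f_out _ _ _ xv).
  have [n [v xv]] := F_total _ xr; have iix : inv T (inv T x) <> inv T x.
    by rewrite invK; apply: nesym.
  by rewrite -{1}[x](@invK _ _ T) (f_in _ _ _ xv)// invK (f_out _ _ _ xv).
- move=> x xT ix; have [xr|[_ xr]] := vars_cover tree Tb0 xT.
    have [n [v xv]] := F_total _ xr.
    by rewrite (f_out _ _ _ xv); case: (f_edge _ _ _ xv ix).
  have [n [v xv]] := F_total _ xr; have iix : inv T (inv T x) <> inv T x.
    by rewrite invK; apply: nesym.
  rewrite -[x](@invK _ _ T) (f_in _ _ _ xv)// invK.
  by have [iv _ _] := f_edge _ _ _ xv iix => /esym.
Qed.

End Root.

Section Isomorphism.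
Variable f : V -> V.
Hypothesis fcor : forall K, corollas T K ->
  exists2 L, corollas T' L & rename_cor f K L.
Hypothesis finv : forall x, vars T x -> inv T' (f x) = f (inv T x).
Hypothesis fnfix : forall x, vars T x -> inv T x <> x -> inv T' (f x) <> f x.

Lemma morphism_co x y : co T x y -> co T' (f x) (f y).
Proof.
case=> K TK /andP[xK yK]; have [L TL KL] := fcor TK; exists L => //.
by apply/andP; split; apply/(rename_fv _ KL); [exists x|exists y].
Qed.

Lemma morphism_local_inj K x y : corollas T K -> x \in fv_cor K ->
  y \in fv_cor K -> f x = f y -> x = y.
Proof.
have [ord _ _ _ _] := tree.
move=> TK xK yK; have [L _ KL] := fcor TK.
exact: rename_inj (ord K TK) KL xK yK.
Qed.

(** No backtracking is created: [y] and [inv T x] lie on one corolla, where [f] is injective. *)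
Lemma morphism_step x y : step T x y -> step T' (f x) (f y).
Proof.
case=> ix yx xy; have [ixT yT] := co_vars xy.
have xT : vars T x by rewrite -[x](@invK _ _ T); apply: inv_vars.
split; [exact: fnfix| |rewrite finv//; exact: morphism_co].
rewrite finv// => fxy; apply: yx; case: xy => K TK /andP[xK yK].
exact: morphism_local_inj TK yK xK fxy.
Qed.

Lemma morphism_reach x y : reach T x y -> reach T' (f x) (f y).
Proof.
elim=> [|u v uv _ IH]; first exact: rtn1_refl.
by apply: rtn1_trans IH; apply: morphism_step.
Qed.

(* A walk without backtracking between two corollas with the same image would
   be sent to a closed one. *)
Lemma morphism_inj x y : vars T x -> vars T y -> f x = f y -> x = y.
Proof.
move=> [K TK xK] [M TM yM] fxy.
case: (rreach_cover tree TK TM) => [E|[w [x0 x0K x0w] [iw wM]]].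
  by apply: morphism_local_inj TK xK _ fxy; rewrite -E.
have [L TL KL] := fcor TK; have [N TN MN] := fcor TM.
have x0T : vars T x0 by exists K.
have wT := reach_vars x0T x0w.
have x0L : f x0 \in fv_cor L by apply/(rename_fv _ KL); exists x0.
case: (no_closed_walk tree' _ (morphism_reach x0w) (fnfix wT iw)).
  by exists L.
exists L => //; rewrite x0L finv//=.
have -> : L = N.
  apply: corollas_eq TL TN _ _; first by apply/(rename_fv _ KL); exists x.
  by apply/(rename_fv _ MN); exists y.
by apply/(rename_fv _ MN); exists (inv T w).
Qed.

Lemma morphism_surj L : corollas T' L -> exists2 K, corollas T K & rename_cor f K L.
Proof.
have [_ conn _ _ _] := tree'; have [K0 TK0] := corollas_nonempty T.
have [L0 TL0 KL0] := fcor TK0 => TL.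
elim: (clos_rt_rtn1 _ _ _ _ (conn _ _ TL0 TL)) => [|M N]; first by exists K0.
case=> e [TM TN [y [yM yN iy _]]] _ [K TK KM].
have [x xK yx] := (rename_fv y KM).1 yM.
have xT : vars T x by exists K.
have [K' TK' xK'] := inv_vars xT; have [N' TN' KN'] := fcor TK'.
exists K' => //; have -> // : N = N'.
apply: corollas_eq TN TN' yN _; apply/(rename_fv _ KN').
by exists (inv T x); rewrite // yx finv.
Qed.

End Isomorphism.
End Morphism.

(** * Isomorphic trees are alpha-equivalent *)

Section FreshCopy.
Context (V : choiceType) (C : bijFunctor V).
Hypothesis V_infinite : infinite_set [set: V]%classic.

Lemma fresh_seq (A : {fset V}) n :
  exists s : seq V, [/\ size s = n, uniq s & forall x, x \in s -> x \notin A].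
Proof.
elim: n => [|n [s [ss us sA]]]; first by exists [::].
have [z] := exists_fresh V_infinite (A `|` [fset x in s]); rewrite !inE negb_or.
case/andP => zA zs; exists (z :: s); split=> /=; [by rewrite ss|by rewrite zs|].
by move=> x; rewrite inE => /predU1P[->|/sA].
Qed.

(** [B] is swapped with as many fresh variables. An involution of all of [V] is its own inverse
    everywhere, so renaming along it needs no condition on domains. *)
Lemma fresh_involution (A B : {fset V}) : B `<=` A -> exists h : V -> V,
  [/\ involutive h, forall x, x \in B -> h x \notin A &
      forall x, x \in A -> x \notin B -> h x = x].
Proof.
move=> /fsubsetP BA; have [s [ss us sA]] := fresh_seq A (size B).
pose b : seq V := B; have ub : uniq b := fset_uniq B.
have bs x : x \in b -> nth x s (index x b) \in s.
  by move=> xb; rewrite mem_nth// ss index_mem.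
have sb x : x \in s -> nth x b (index x s) \in b.
  by move=> xs; rewrite mem_nth// -/b -ss index_mem.
have nbs x : x \in s -> (x \in b) = false.
  by move=> /sA xA; apply: contraNF xA => /BA.
exists (fun x => if x \in b then nth x s (index x b)
                 else if x \in s then nth x b (index x s) else x).
split=> [x|x xB|x xA /negbTE xB]; last 2 first.
- by rewrite (xB : x \in b); apply/sA/bs.
- by rewrite -[x \in b]/(x \in B) xB; case: ifP => // /sA; rewrite xA.
case: (boolP (x \in b)) => [xb|xb].
  rewrite nbs ?bs// index_uniq ?ss ?index_mem//.
  by rewrite (set_nth_default x) ?index_mem// nth_index.
case: (boolP (x \in s)) => [xs|xs]; last by rewrite (negbTE xb) (negbTE xs).
rewrite sb// index_uniq -?ss ?index_mem//.
by rewrite (set_nth_default x) ?index_mem// nth_index.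
Qed.

Lemma fresh_copy (T : graph C) (A : {fset V}) : exists (T2 : graph C) (h : V -> V),
  [/\ involutive h,
      forall x, vars T x -> inv T x = x -> h x = x,
      forall x, vars T x -> inv T x <> x -> h x \notin A /\ ~ vars T (h x),
      corollas T2 = [set L | exists2 K, corollas T K & rename_cor h K L]%classic &
      forall x, inv T2 (h x) = h (inv T x)].
Proof.
have [D DP] := vars_finite T.
pose B := [fset x in D | inv T x != x].
have [|h [hK hB hfix]] := @fresh_involution (A `|` D) B.
  by apply/fsubsetP => x; rewrite !inE => /andP[-> _]; rewrite orbT.
have /choice[r rP] (K : corolla C) : exists L, rename_cor h K L.
  exact: (@rename_exists _ _ h h K (fun x _ => hK x)).
have h_inj x y : h x = h y -> x = y by exact: (can_inj hK).
have fv_r K x : x \in fv_cor (r K) <-> h x \in fv_cor K.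
  split=> [/(rename_fv _ (rP K))[y yK ->]|xK]; first by rewrite hK.
  by apply/(rename_fv _ (rP K)); exists (h x); rewrite ?hK.
pose cors := (r @` corollas T)%classic.
have ne : (cors !=set0)%classic.
  by have [K TK] := corollas_nonempty T; exists (r K), K.
have fin : finite_set cors by apply/finite_image/corollas_finite.
have dis K L : cors K -> cors L -> K <> L -> [disjoint fv_cor K & fv_cor L].
  move=> [K' TK' <-] [L' TL' <-] KL; apply/fdisjointE => x /fv_r xK /fv_r xL.
  by apply: KL; rewrite (corollas_eq TK' TL' xK xL).
pose inv2 x := h (inv T (h x)).
have inv2K : involutive inv2 by move=> x; rewrite /inv2 hK invK hK.
have out2 x : ~ vars_of cors x -> inv2 x = x.
  move=> nx; rewrite /inv2 (inv_outside (g := T) (x := h x)) ?hK// => -[K TK xK].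
  by apply: nx; exists (r K); [exists K|apply/fv_r].
exists (Graph ne fin dis inv2K out2), h; split=> //=.
- move=> x /DP xD ix; apply: hfix; first by rewrite !inE xD orbT.
  by rewrite !inE ix eqxx andbF.
- move=> x /DP xD /eqP ix; have := hB x.
  rewrite !inE xD ix negb_or => /(_ isT)/andP[hA hD]; split=> //.
  by move=> /DP; apply/negP.
- apply/seteqP; split=> [_ [K TK <-]|L [K TK KL]] /=; first by exists K.
  by exists K => //; apply: rename_unique (rP K) KL => x y _ _; apply: h_inj.
- by move=> x; rewrite /inv2 hK.
Qed.

(** The map [f] may permute names of [T], while a renaming must use fresh ones. With [T2] a copy of
    [T'] whose edges avoid the names of both trees, [h \o f] from [T] and [h] from [T'] are each a
    single renaming onto [T2]. *)
Lemma iso_alpha (T T' : graph C) (f : V -> V) :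
  (forall x y, vars T x -> vars T y -> f x = f y -> x = y) ->
  (forall K, corollas T K -> exists2 L, corollas T' L & rename_cor f K L) ->
  (forall L, corollas T' L -> exists2 K, corollas T K & rename_cor f K L) ->
  (forall x, vars T x -> inv T' (f x) = f (inv T x)) ->
  (forall x, vars T x -> inv T x = x -> f x = x) ->
  alpha_graph T T'.
Proof.
move=> finj fcor fsurj finv ffix; have [D DP] := vars_finite T.
have [T2 [h [hK hfix hfresh T2E inv2]]] := fresh_copy T' D.
have h_inj x y : h x = h y -> x = y by exact: (can_inj hK).
have fvars x : vars T x -> vars T' (f x).
  move=> [K TK xK]; have [L TL KL] := fcor K TK; exists L => //.
  by apply/(rename_fv _ KL); exists x.
have fleg x : vars T x -> inv T x = x -> inv T' (f x) = f x.
  by move=> xT ix; rewrite finv// ix.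
have hf_leg x : vars T x -> inv T x = x -> h (f x) = x.
  by move=> xT ix; rewrite hfix; [exact: ffix|exact: fvars|exact: fleg].
apply: (rst_trans _ _ _ T2); last apply: rst_sym; apply: rst_step.
  exists (h \o f); split=> /=.
  - by move=> x [xT ix]; apply: hf_leg.
  - move=> x xT hfx; case: (pselect (inv T x = x)) => ix.
      by case: hfx; apply: hf_leg.
    have fix' : inv T' (f x) <> f x.
      by rewrite finv// => E; apply: ix; apply: finj => //; apply: inv_vars.
    by have [hD _] := hfresh _ (fvars _ xT) fix' => /DP; apply/negP.
  - by move=> x y xT yT /h_inj; apply: finj.
  - rewrite T2E; apply/seteqP; split=> [M [L TL LM]|M [K TK KM]] /=.
      by have [K TK KL] := fsurj L TL; exists K => //; apply: rename_comp KL LM.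
    have [L TL KL] := fcor K TK; exists L => //.
    have [M' LM'] : exists M', rename_cor h L M'.
      exact: (@rename_exists _ _ h h L (fun x _ => hK x)).
    rewrite (@rename_unique _ _ (h \o f) K M M')//; last exact: rename_comp KL LM'.
    by move=> x y xK yK /h_inj; apply: finj; exists K.
  - by move=> x xT; rewrite inv2 finv.
exists h; split=> //.
- by move=> x [xT ix]; apply: hfix.
- move=> x xT hx; case: (pselect (inv T' x = x)) => ix; first by case: hx; apply: hfix.
  by case: (hfresh x xT ix).
- by move=> x y _ _; apply: h_inj.
Qed.

End FreshCopy.

(** * Trees with equal readings are alpha-equivalent *)

Section Injectivity.
Context (V : choiceType) (C : bijFunctor V).
Hypothesis V_infinite : infinite_set [set: V]%classic.

Lemma ordinary_reads_alpha (T T' : graph C) c d : ordinary_tree T -> ordinary_tree T' ->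
  reads T c -> reads T' d -> eqC c d -> alpha_graph T T'.
Proof.
move=> tree tree' rc rd cd.
have [_ cfv] := reads_lin (or_introl tree) rc.
have [_ dfv] := reads_lin (or_introl tree') rd.
have [_ _ fvcd] := eqC_lin cd.
have fvE x : fv T x <-> fv T' x by rewrite -cfv -dfv fvcd.
have den_cd := (den_mu_eq (@flipK _ _ T') (@at_corolla_act _ _ T') V_infinite).1
  _ _ _ cd (@port V).
case: rc cfv cd fvcd den_cd => [Y b t Tb tout|e e2 x y Te]; last first.
  by have [/(_ _ Te)] := tree.
move=> _ _ _ den_cd.
case: rd dfv den_cd => [Z b' u Tb' uout|e e2 x y Te]; last first.
  by have [/(_ _ Te)] := tree'.
move=> _ den_cd; have {}den_cd := den_cd.2 (outs_den Tb' uout).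
have [f [fcor finv fnfix ffix]] := exists_morphism tree fvE Tb tout den_cd.
apply: (iso_alpha V_infinite _ fcor _ finv ffix).
  by move=> x y; apply: morphism_inj fcor finv fnfix x y.
exact: morphism_surj fcor finv.
Qed.

(** In the one-point model where no operation ever holds, every wire holds. *)
Lemma op_neq_wire (Y : {fset V}) (b : C Y) t x y :
  ~ eqC (Op b t) (Cut (Var C x) (Var C y)).
Proof.
pose itp (X : {fset V}) (a : C X) (g : X -> unit) := False.
have itp_act (X W : {fset V}) (sigma : fbij W X) (a : C X) g :
  itp X a g <-> itp W (act sigma a) (fun w => g (sigma w)) by [].
move=> E; have := (den_mu_eq (fun e : unit => erefl : id (id e) = e) itp_act
  V_infinite).1 _ _ _ E (fun=> tt).
by case=> _ [|g []]; first by exists tt.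
Qed.

Lemma graph_eq (T T' : graph C) : corollas T = corollas T' -> inv T =1 inv T' -> T = T'.
Proof.
case: T T' => T i n1 f1 d1 k1 o1 [T' i' n2 f2 d2 k2 o2] /= E /funext E'.
case: T' / E n2 f2 d2 o2 => n2 f2 d2 o2; case: i' / E' k2 o2 => k2 o2.
by congr Graph; apply: Prop_irrelevance.
Qed.

(** An exceptional tree is determined by its two legs, which are the free variables of its reading,
    so two of them with equal readings are the same graph. *)
Lemma reads_alpha (T T' : graph C) c d : unrooted_tree T -> unrooted_tree T' ->
  reads T c -> reads T' d -> eqC c d -> alpha_graph T T'.
Proof.
move=> tree tree' rc rd cd0; case: (rc) (rd) (cd0) => [Y b t Tb _|e e2 x y Te exy ix iy].
  case=> [Z b' u Tb' _|e e2 x y Te exy ix iy] cd; last by case: (op_neq_wire cd).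
  have otree := exceptional_ordinary tree Tb.
  have otree' := exceptional_ordinary tree' Tb'.
  exact: ordinary_reads_alpha otree otree' rc rd cd0.
case=> [Z b' u Tb' _ cd|e' e2' x' y' Te' exy' ix' iy' cd].
  by case: (op_neq_wire (eqC_sym cd)).
have [_ _ /= ee'] := eqC_lin cd.
have [TE iT] := exceptional_wire tree Te; have [TE' iT'] := exceptional_wire tree' Te'.
rewrite (_ : T' = T); first exact: rst_refl.
apply: graph_eq => [|z]; last by rewrite iT iT'.
rewrite TE TE'; have E : e' = e by rewrite exy exy' -ee'.
case: e / E e2 {Te TE exy} => e2; congr [set Special C _]%classic.
exact: Prop_irrelevance.
Qed.

End Injectivity.

(** * Grafting trees *)

Section Single.
Context (V : choiceType) (C : bijFunctor V).

Definition single (K : corolla C) : graph C.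
Proof.
apply: (@Graph _ _ [set K]%classic id).
- by exists K.
- exact: finite_set1.
- by move=> L M -> ->.
- by [].
- by [].
Defined.

Lemma single_ordinary (X : {fset V}) (a : C X) :
  ordinary_tree (single (Ordinary a)).
Proof.
split=> [K ->|K L -> ->|e K|e e' K L|n K n2 _ adj] //=; first exact: rt_refl.
- by case=> _ _ [x []].
- by case=> _ _ [x []].
- by have [e [_ _ [x []]]] := adj (Ordinal (ltnW (ltnW n2))).
Qed.

Lemma single_special (e : {fset V}) (e2 : #|` e| == 2) :
  exceptional_tree (single (Special C e2)).
Proof. by split=> //; exists e, e2. Qed.

End Single.

Section Cyclic.

Lemma cyclic_closed n (P : 'I_n -> Prop) i j :
  (forall i, P i -> P (ordS i)) -> P i -> P j.
Proof.
move=> PS Pi.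
have Pk k : P (iter k (@ordS n) i) by elim: k => //= k; apply: PS.
have iterE k : iter k (@ordS n) i = (i + k) %% n :> nat.
  elim: k => [|k IH] /=; first by rewrite addn0 modn_small.
  by rewrite IH -addn1 modnDml addn1 addnS.
suff <- : iter (n - i + j) (@ordS n) i = j by [].
apply/val_inj; rewrite /= iterE addnA subnKC; last exact: ltnW.
by rewrite modnDl modn_small.
Qed.

Lemma ordS2_neq n (i : 'I_n) : 2 < n -> ordS (ordS i) <> i.
Proof.
move=> n2 /(congr1 val) /=; rewrite -addn1 modnDml addn1 => E.
have iltn := ltn_ord i; case: (ltnP i.+2 n) => h.
  by rewrite modn_small in E; lia.
by move: E; rewrite -(subnK h) modnDr modn_small; lia.
Qed.

End Cyclic.

Section Graft.
Context (V : choiceType) (C : bijFunctor V).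
Hypothesis V_infinite : infinite_set [set: V]%classic.
Variables (T1 T2 : graph C) (x1 x2 : V).
Hypotheses (tree1 : ordinary_tree T1) (tree2 : ordinary_tree T2).
Hypothesis dis : forall x, vars T1 x -> vars T2 x -> False.
Hypotheses (x1T : vars T1 x1) (ix1 : inv T1 x1 = x1).
Hypotheses (x2T : vars T2 x2) (ix2 : inv T2 x2 = x2).

Definition graft_cor := (corollas T1 `|` corollas T2)%classic.

(** Each involution is the identity outside its own tree, so away from the two grafted legs the
    composite acts on each tree as its own involution. *)
Definition graft_inv z :=
  if z == x1 then x2 else if z == x2 then x1 else inv T1 (inv T2 z).

Lemma x12 : x1 == x2 = false.
Proof. by apply/eqP => E; apply: (dis x1T); rewrite E. Qed.

Lemma graft_inv1 z : vars T1 z -> z <> x1 -> graft_inv z = inv T1 z.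
Proof.
move=> zT /eqP/negbTE zx1; rewrite /graft_inv zx1.
case: eqP => [E|_]; first by case: (dis zT); rewrite E.
by rewrite (inv_outside (g := T2))// => /(dis zT).
Qed.

Lemma graft_inv2 z : vars T2 z -> z <> x2 -> graft_inv z = inv T2 z.
Proof.
move=> zT /eqP/negbTE zx2; rewrite /graft_inv zx2.
case: eqP => [E|_]; first by case: (@dis z) => //; rewrite E.
by rewrite (inv_outside (g := T1))// => /dis; apply; apply: inv_vars.
Qed.

Lemma graft_invx1 : graft_inv x1 = x2.
Proof. by rewrite /graft_inv eqxx. Qed.

Lemma graft_invx2 : graft_inv x2 = x1.
Proof. by rewrite /graft_inv eq_sym x12 eqxx. Qed.

Lemma graft_out z : ~ vars T1 z -> ~ vars T2 z -> graft_inv z = z.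
Proof.
move=> z1 z2; rewrite /graft_inv; case: eqP => [E|_]; first by rewrite E in z1.
case: eqP => [E|_]; first by rewrite E in z2.
by rewrite (inv_outside z2) (inv_outside z1).
Qed.

Lemma graft_invK : involutive graft_inv.
Proof.
move=> z; case: (pselect (z = x1)) => [->|zx1]; first by rewrite graft_invx1 graft_invx2.
case: (pselect (z = x2)) => [->|zx2]; first by rewrite graft_invx2 graft_invx1.
case: (pselect (vars T1 z)) => [z1|z1].
  rewrite (graft_inv1 z1 zx1) graft_inv1 ?invK//; first exact: inv_vars.
  by move=> /(congr1 (inv T1)); rewrite invK ix1.
case: (pselect (vars T2 z)) => [z2|z2]; last by rewrite !graft_out.
rewrite (graft_inv2 z2 zx2) graft_inv2 ?invK//; first exact: inv_vars.
by move=> /(congr1 (inv T2)); rewrite invK ix2.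
Qed.

Lemma graft_ne : (graft_cor !=set0)%classic.
Proof. by have [K TK] := corollas_nonempty T1; exists K; left. Qed.

Lemma graft_finite : finite_set graft_cor.
Proof. by rewrite /graft_cor finite_setU; split; apply: corollas_finite. Qed.

Lemma graft_disjoint K L : graft_cor K -> graft_cor L -> K <> L ->
  [disjoint fv_cor K & fv_cor L].
Proof.
move=> [TK|TK] [TL|TL] KL; [exact: corollas_disjoint TK TL KL| | |exact: corollas_disjoint TK TL KL];
by apply/fdisjointE => z zK zL; apply: (@dis z); do [by exists K|by exists L].
Qed.

Lemma graft_outside x : ~ vars_of graft_cor x -> graft_inv x = x.
Proof.
by move=> nx; apply: graft_out => -[K TK xK]; apply: nx; exists K => //; [left|right].
Qed.

Definition graft : graph C :=
  Graph graft_ne graft_finite graft_disjoint graft_invK graft_outside.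

Lemma graft_joins e K L : joins graft e K L <->
  [\/ joins T1 e K L, joins T2 e K L,
      [/\ corollas T1 K, corollas T2 L, x1 \in fv_cor K, x2 \in fv_cor L &
          e = [fset x1; x2]] |
      [/\ corollas T2 K, corollas T1 L, x2 \in fv_cor K, x1 \in fv_cor L &
          e = [fset x1; x2]]].
Proof.
split.
  case=> TK TL [x [xK ixL ix eE]]; move: ixL ix eE => /=.
  case: (pselect (x = x1)) => [xx1|xx1]; first rewrite xx1 graft_invx1 => x2L _ eE.
    constructor 3; split=> //; last by rewrite -xx1.
    + by case: TK => // TK; case: (@dis x1) => //; exists K; rewrite // -xx1.
    + by case: TL => // TL; case: (@dis x2) => //; exists L.
  case: (pselect (x = x2)) => [xx2|xx2]; first rewrite xx2 graft_invx2 => x1L _ eE.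
    constructor 4; split=> //; [| |by rewrite -xx2|by rewrite eE fsetUC].
    + by case: TK => // TK; case: (@dis x2) => //; exists K; rewrite // -xx2.
    + by case: TL => // TL; case: (@dis x1) => //; exists L.
  case: TK => TK.
    have xT : vars T1 x by exists K.
    rewrite (graft_inv1 xT xx1) => ixL ix eE; constructor 1.
    split=> //; last by exists x.
    by case: TL => // TL; case: (dis (inv_vars xT)); exists L.
  have xT : vars T2 x by exists K.
  rewrite (graft_inv2 xT xx2) => ixL ix eE; constructor 2.
  split=> //; last by exists x.
  by case: TL => // TL; case: (@dis (inv T2 x)); [exists L|apply: inv_vars].
case.
- case=> TK TL [x [xK ixL ix eE]]; split; [by left|by left|].
  have E : graft_inv x = inv T1 x.
    by apply: graft_inv1 => [|xx1]; [exists K|apply: ix; rewrite xx1].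
  by exists x; rewrite /= E.
- case=> TK TL [x [xK ixL ix eE]]; split; [by right|by right|].
  have E : graft_inv x = inv T2 x.
    by apply: graft_inv2 => [|xx1]; [exists K|apply: ix; rewrite xx1].
  by exists x; rewrite /= E.
- case=> TK TL x1K x2L eE; split; [by left|by right|].
  by exists x1; rewrite /= graft_invx1; split=> //; apply/eqP; rewrite eq_sym x12.
- case=> TK TL x2K x1L eE; split; [by right|by left|].
  by exists x2; rewrite /= graft_invx2 fsetUC; split=> //; apply/eqP; rewrite x12.
Qed.

Lemma cor_dis K z : corollas T1 K -> corollas T2 K -> z \in fv_cor K -> False.
Proof. by move=> TK TK' zK; apply: (@dis z); exists K. Qed.

Lemma joins_dis e e' K L M N : joins T1 e K L -> joins T2 e' M N ->
  [/\ K <> M, K <> N, L <> M & L <> N].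
Proof.
case=> TK TL [x [xK xL _ _]] [TM TN [y [yM yN _ _]]].
by split=> E; [apply: (cor_dis TK _ xK)|apply: (cor_dis TK _ xK)
  |apply: (cor_dis TL _ xL)|apply: (cor_dis TL _ xL)]; rewrite E.
Qed.

Lemma cor1_x2 K : corollas T1 K -> x2 \in fv_cor K -> False.
Proof. by move=> TK xK; apply: (@dis x2) => //; exists K. Qed.

Lemma cor2_x1 K : corollas T2 K -> x1 \in fv_cor K -> False.
Proof. by move=> TK xK; apply: (@dis x1) => //; exists K. Qed.

(** The delicate point is acyclicity. A cycle that changes sides must use the single new edge in
    both directions, and one that does not is a cycle of [T1] or of [T2]. *)
Lemma graft_tree : ordinary_tree graft.
Proof.
have [ord1 conn1 nl1 nm1 nc1] := tree1; have [ord2 conn2 nl2 nm2 nc2] := tree2.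
have [K1 TK1 xK1] := x1T; have [K2 TK2 xK2] := x2T.
have adj1 K L : clos_refl_trans _ (adjacent T1) K L -> clos_refl_trans _ (adjacent graft) K L.
  elim=> [M N [e MN]|M|M N P _ MN _ NP]; [|exact: rt_refl|exact: rt_trans MN NP].
  by apply: rt_step; exists e; apply/graft_joins; constructor 1.
have adj2 K L : clos_refl_trans _ (adjacent T2) K L -> clos_refl_trans _ (adjacent graft) K L.
  elim=> [M N [e MN]|M|M N P _ MN _ NP]; [|exact: rt_refl|exact: rt_trans MN NP].
  by apply: rt_step; exists e; apply/graft_joins; constructor 2.
have K12 : adjacent graft K1 K2.
  by exists [fset x1; x2]; apply/graft_joins; constructor 3.
have K21 : adjacent graft K2 K1.
  by exists [fset x1; x2]; apply/graft_joins; constructor 4.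
split.
- by move=> K [/ord1|/ord2].
- move=> K L [TK|TK] [TL|TL]; [exact/adj1/conn1| | |exact/adj2/conn2].
    apply: rt_trans (adj1 _ _ (conn1 _ _ TK TK1)) _.
    exact: rt_trans (rt_step _ _ _ _ K12) (adj2 _ _ (conn2 _ _ TK2 TL)).
  apply: rt_trans (adj2 _ _ (conn2 _ _ TK TK2)) _.
  exact: rt_trans (rt_step _ _ _ _ K21) (adj1 _ _ (conn1 _ _ TK1 TL)).
- move=> e K /graft_joins[/nl1//|/nl2//|[TK _ _ xK _]|[_ TK xK _ _]];
  exact: cor1_x2 TK xK.
- move=> e e' K L /graft_joins[j1|j2|[TK TL xK xL ->]|[TK TL xK xL ->]]
    /graft_joins[j1'|j2'|[TK' TL' xK' xL' ->]|[TK' TL' xK' xL' ->]] //.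
  + exact: nm1 j1 j1'.
  + by have [] := joins_dis j1 j2'.
  + by case: j1 => _ TL _; case: (cor1_x2 TL xL').
  + by case: j1 => TK _ _; case: (cor1_x2 TK xK').
  + by have [] := joins_dis j1' j2.
  + exact: nm2 j2 j2'.
  + by case: j2 => TK _ _; case: (cor2_x1 TK xK').
  + by case: j2 => _ TL _; case: (cor2_x1 TL xL').
  + by case: j1' => _ TL' _; case: (cor1_x2 TL' xL).
  + by case: j2' => TK' _ _; case: (cor2_x1 TK' xK).
  + by case: j1' => TK' _ _; case: (cor1_x2 TK' xK).
  + by case: j2' => _ TL' _; case: (cor2_x1 TL' xL).
- move=> n K n2 K_inj adj.
  pose b12 i := x1 \in fv_cor (K i) /\ x2 \in fv_cor (K (ordS i)).
  pose b21 i := x2 \in fv_cor (K i) /\ x1 \in fv_cor (K (ordS i)).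
  have side i : [\/ adjacent T1 (K i) (K (ordS i)), adjacent T2 (K i) (K (ordS i)),
      [/\ corollas T1 (K i), corollas T2 (K (ordS i)) & b12 i] |
      [/\ corollas T2 (K i), corollas T1 (K (ordS i)) & b21 i]].
    have [e /graft_joins[j|j|[? ? ? ? _]|[? ? ? ? _]]] := adj i.
    + by constructor 1; exists e.
    + by constructor 2; exists e.
    + by constructor 3.
    + by constructor 4.
  pose in1 i := exists2 x, vars T1 x & x \in fv_cor (K i).
  pose in2 i := exists2 x, vars T2 x & x \in fv_cor (K i).
  have adj1_in i : adjacent T1 (K i) (K (ordS i)) -> in1 i /\ in1 (ordS i).
    by case=> e [TK TL [x [xK xL _ _]]]; split;
      [exists x => //; exists (K i)|exists (inv T1 x) => //; exists (K (ordS i))].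
  have adj2_in i : adjacent T2 (K i) (K (ordS i)) -> in2 i /\ in2 (ordS i).
    by case=> e [TK TL [x [xK xL _ _]]]; split;
      [exists x => //; exists (K i)|exists (inv T2 x) => //; exists (K (ordS i))].
  have in12 i : in1 i -> in2 i -> False.
    case=> x xT xK [y yT yK].
    have graftK : graft_cor (K i) by have [e []] := adj i.
    case: graftK => TK; [apply: (@dis y) => //|apply: (@dis x) => //]; by exists (K i).
  have b12_in i : b12 i -> in1 i /\ in2 (ordS i) by case; split; [exists x1|exists x2].
  have b21_in i : b21 i -> in2 i /\ in1 (ordS i) by case; split; [exists x2|exists x1].
  have i0 : 'I_n by exists 0; lia.
  have all1 i j : (forall i, ~ b12 i) -> in1 i -> in1 j.
    move=> nb; apply: (@cyclic_closed n in1) => k k1.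
    case: (side k) => [/adj1_in[]//|/adj2_in[/(in12 _ k1)//]|[_ _ /nb//]|[_ _ /b21_in[_]]//].
  have all2 i j : (forall i, ~ b21 i) -> in2 i -> in2 j.
    move=> nb; apply: (@cyclic_closed n in2) => k k2.
    case: (side k) => [/adj1_in[/in12/(_ k2)//]|/adj2_in[]//|[_ _ /b12_in[_]]//|[_ _ /nb//]].
  case: (pselect (exists i, b12 i)) => [[i bi]|nb12].
    have [i1 i2] := b12_in _ bi; case: (pselect (exists j, b21 j)) => [[j bj]|nb21].
      (* The two crossings meet the same two corollas, so the cycle would close after two steps. *)
      case: bi bj => xi yi [yj xj].
      have Kj : K j = K (ordS i).
        have [e [TK _ _]] := adj j; have [e' [TL _ _]] := adj (ordS i).
        exact: (corollas_eq (T := graft) TK TL yj yi).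
      have Ki : K i = K (ordS j).
        have [e [TK _ _]] := adj i; have [e' [TL _ _]] := adj (ordS j).
        exact: (corollas_eq (T := graft) TK TL xi xj).
      apply: (@ordS2_neq _ i n2); rewrite -(K_inj _ _ Kj).
      exact/esym/K_inj.
    (* With no crossing back, the cycle stays in [T2] once it is there, yet it must return to [K i]
       in [T1]. *)
    by apply: (in12 i i1); apply: all2 i2 => k bk; apply: nb21; exists k.
  have {}nb12 i : ~ b12 i by move=> bi; apply: nb12; exists i.
  case: (pselect (exists i, in1 i)) => [[i i1]|n1].
    apply: (nc1 n K n2 K_inj) => k; have k1 := all1 i k nb12 i1.
    case: (side k) => [//|/adj2_in[/(in12 _ k1)//]|[_ _ /nb12//]|[_ _ /b21_in[/(in12 _ k1)//]]].
  apply: (nc2 n K n2 K_inj) => k.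
  case: (side k) => [/adj1_in[k1 _]|//|[_ _ /nb12//]|[_ _ /b21_in[_ k1]]].
    by case: n1; exists k.
  by case: n1; exists (ordS k).
Qed.

End Graft.

(** * Every command is read off a tree *)

Section GraftReads.
Context (V : choiceType) (C : bijFunctor V).
Hypothesis V_infinite : infinite_set [set: V]%classic.
Variables (T1 T2 : graph C) (x1 x2 : V).
Hypotheses (tree1 : ordinary_tree T1) (tree2 : ordinary_tree T2).
Hypothesis dis : forall x, vars T1 x -> vars T2 x -> False.
Hypotheses (x1T : vars T1 x1) (ix1 : inv T1 x1 = x1).
Hypotheses (x2T : vars T2 x2) (ix2 : inv T2 x2 = x2).

Let T := graft dis x1T ix1 x2T ix2.

(** Within [T1], grafting changes the involution only at [x1]. The branch at another half-edge of
    the corolla of [x1] never meets [x1], because branches are disjoint. *)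
Lemma out_graft1 x s : vars T1 x -> co T1 x x1 -> x <> x1 -> out T1 x s -> out T x s.
Proof.
move=> xT xx1 nx; apply: out_transfer => z xz; split; last by move=> K TK; left.
apply: graft_inv1 => //; first exact: reach_vars xT xz.
move=> zx1; apply: nx; apply: (reach_disjoint tree1 xx1 xz).
by rewrite zx1; apply: rtn1_refl.
Qed.

Lemma out_graft2 x s : vars T2 x -> co T2 x x2 -> x <> x2 -> out T2 x s -> out T x s.
Proof.
move=> xT xx2 nx; apply: out_transfer => z xz; split; last by move=> K TK; right.
apply: graft_inv2 => //; first exact: reach_vars xT xz.
move=> zx2; apply: nx; apply: (reach_disjoint tree2 xx2 xz).
by rewrite zx2; apply: rtn1_refl.
Qed.

(** All readings being equal, the root may be put at the corolla carrying [x]. When [x] is a leg, it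
    is then directly an argument of the operation. *)
Lemma reads_at (U : graph C) x c : ordinary_tree U -> vars U x -> realizes U c ->
  exists (Y : {fset V}) (b : C Y) (t : Y -> term C),
    [/\ corollas U (Ordinary b), x \in Y, forall y, out U (val y) (t y) &
        eqC c (Op b t)].
Proof.
move=> tree [K UK xK] [d rd cd]; have [ord _ _ _ _] := tree; have := ord K UK.
case: K UK xK => // Y b Ub xY _; have [t tout] := outs_exist tree Ub.
exists Y, b, t; split=> //; apply: eqC_trans cd _.
by apply: (reads_eq V_infinite (or_introl tree) rd); apply: reads_op.
Qed.

Lemma graft_realizes c d : realizes T1 c -> realizes T2 d ->
  linC (Cut (Mu x1 c) (Mu x2 d)) -> realizes T (Cut (Mu x1 c) (Mu x2 d)).
Proof.
move=> /(reads_at tree1 x1T)[Y [b [t [Tb x1Y tout cbt]]]].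
move=> /(reads_at tree2 x2T)[Z [b' [u [Tb' x2Z uout dbu]]]] l.
have [[lc x1c] [ld x2d] dcd] := l.
pose y1 : Y := [` x1Y].
have ty1 : t y1 = Var C x1 by apply: out_unique (tout y1) _; apply: out_leg.
have tE : t = setf t y1 (Var C x1).
  by apply/funext => y; rewrite /setf; case: eqVneq => // ->.
have [_ [_ dt] _] := eqC_lin cbt.
have tfresh y : y != y1 -> x1 \notin fvT (t y).
  move=> yy1; apply/negP => x1y; apply: ((fdisjointE _ _).1 (dt _ _ yy1) x1) => //.
  by rewrite ty1 /= inE.
have eq1 : eqC (Cut (Mu x1 c) (Mu x2 d)) (Cut (Mu x1 (Op b t)) (Mu x2 (Op b' u))).
  by apply: eqC_cut => //; apply: eqT_mu.
have [_ l2 _] := eqC_lin eq1.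
have eq2 := eqC_MU2 V_infinite l2.
rewrite {2}tE subst1_setf// in eq2.
(* Contracting the cut puts [Mu x2 (Op b' u)] in place of the variable [x1], and this term is the
   branch of the graft seen through [x1]. *)
exists (Op b (setf t y1 (Mu x2 (Op b' u)))); last exact: eqC_trans eq1 eq2.
apply: reads_op; first by left.
have bT (y : Y) : vars T1 (val y) by exists (Ordinary b); rewrite //= fsvalP.
have b'T (z : Z) : vars T2 (val z) by exists (Ordinary b'); rewrite //= fsvalP.
have invx1 : inv T x1 = x2 by apply: graft_invx1.
move=> y; rewrite /setf; case: eqVneq => [->|yy1].
  have := @out_edge _ _ T x1 _ b' u; rewrite invx1; apply => //.
  - by apply/eqP; rewrite eq_sym (x12 dis x1T x2T).
  - by right.
  - move=> z zx2; apply: out_graft2 => //.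
    by exists (Ordinary b'); rewrite //= fsvalP.
  - by move=> z zx2; apply: out_unique (uout z) _; rewrite zx2; apply: out_leg.
apply: out_graft1 => //; first by exists (Ordinary b); rewrite //= fsvalP.
by move=> yx1; case/eqP: yy1; apply: val_inj.
Qed.

End GraftReads.

(** * Existence of trees, by induction on the size of commands *)

Section Presentable.
Context (V : choiceType) (C : bijFunctor V).
Hypothesis V_infinite : infinite_set [set: V]%classic.

(** Quantifying over the names [A] to be avoided strengthens the induction hypothesis: it yields
    trees with disjoint variables, ready to be grafted. *)
Definition presentable (c : command C) := forall A : {fset V}, exists T : graph C,
  [/\ unrooted_tree T, forall x, vars T x -> inv T x <> x -> x \notin A &
      realizes T c].

Lemma presentable_eq c d : eqC c d -> presentable d -> presentable c.
Proof.
move=> cd dP A; have [T [? ? [e re de]]] := dP A; exists T; split=> //.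
by exists e => //; apply: eqC_trans cd de.
Qed.

Lemma presentable_wire x y : x != y -> presentable (Cut (Var C x) (Var C y)).
Proof.
move=> xy A; have e2 : #|` [fset x; y]| == 2 by rewrite cardfs2 xy.
exists (single (Special C e2)); split=> //; first by right; apply: single_special.
exists (Cut (Var C x) (Var C y)); first by apply: (reads_wire (e2 := e2)).
by apply: eqC_refl; split=> //=; rewrite fdisjoint1X inE.
Qed.

(** [X] only indexes the arguments, so the legs of the tree must be the variables [g x]. By
    linearity [g] is injective, and renaming the corolla along it costs one use of (MU4). *)
Lemma presentable_corolla (X : {fset V}) (a : C X) (t : X -> term C) (g : X -> V) :
  (forall x, t x = Var C (g x)) -> linC (Op a t) -> presentable (Op a t).
Proof.
move=> tg l A; have [h hg] := extend_fun g.
have [_ dt] := l.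
have h_inj x y : x \in X -> y \in X -> h x = h y -> x = y.
  move=> xX yX hxy; apply: contrapT => xy.
  have /dt : [` xX] != [` yX] by apply/eqP => /(congr1 val).
  rewrite !tg -!hg /= hxy => /fdisjointE/(_ (h y)); apply; by rewrite inE.
have /choice[k kP] (y : V) : exists x, forall x', x' \in X -> h x' = y -> x = x'.
  case: (pselect (exists2 x, x \in X & h x = y)) => [[x xX xy]|nx].
    by exists x => x' xX' xy'; apply: h_inj; rewrite // xy.
  by exists y => x' xX' xy'; case: nx; exists x'.
have [|L] := @rename_exists _ _ h k (Ordinary a); first by move=> x xX; apply: kP.
case/rename_ordinaryE => Z [tau [ht _]].
exists (single (Ordinary (act tau a))); split=> //.
  by left; apply: single_ordinary.
exists (Op (act tau a) (fun z => t (tau z))); last exact: eqC_MU4.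
by apply: reads_op => // z; rewrite tg -hg ht; apply: out_leg.
Qed.

Lemma subst1_wire x v s : v != x -> subst1 (Cut (Var C x) (Var C v)) s x = Cut s (Var C v).
Proof. by move=> vx; rewrite /subst1 /= !updE eqxx (negbTE vx). Qed.

(** Here [c] is a wire with one end at [x], so contraction merely attaches [s] to the other end.
    This replaces grafting, which is restricted to ordinary trees. *)
Lemma wire_absorb (T : graph C) c x s : realizes T c -> unrooted_tree T ->
  ~ ordinary_tree T -> linC (Cut (Mu x c) s) ->
  exists2 v, linC (Cut s (Var C v)) & eqC (Cut (Mu x c) s) (Cut s (Var C v)).
Proof.
case=> d rd cd tree nord l; have [[lc xc] ls dcs] := l.
suff [v vx cv] : exists2 v, v != x & eqC c (Cut (Var C x) (Var C v)).
  have eq1 : eqC (Cut (Mu x c) s) (Cut (Mu x (Cut (Var C x) (Var C v))) s).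
    by apply: eqC_cut => //; [apply: eqT_mu|apply: eqT_refl].
  have [_ l2 _] := eqC_lin eq1; have := eqC_MU2 V_infinite l2.
  rewrite subst1_wire// => eq2; have [_ l3 _] := eqC_lin eq2.
  by exists v => //; apply: eqC_trans eq1 eq2.
case: rd cd => [Y b t Tb|e e2 u v Te euv iu iv] cd.
  by case: nord; apply: exceptional_ordinary Tb.
have [_ [_ _ uv] fvE] := eqC_lin cd.
have vu : v != u by move: uv; rewrite /= fdisjoint1X inE eq_sym.
move: xc; rewrite fvE !inE => /orP[] /eqP ->; first by exists v.
exists u; first by rewrite eq_sym.
apply: eqC_trans cd (eqC_MU1 _); split=> //.
Qed.

Lemma eqT_fresh x (c : command C) (A : {fset V}) : linC c -> x \in fvC c ->
  exists x' c', [/\ x' \notin A, eqT (Mu x c) (Mu x' c') & sizeC c' = sizeC c].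
Proof.
move=> lc xc; have [x'] := exists_fresh V_infinite (A `|` varsC c).
rewrite !inE negb_or => /andP[x'A x'c].
exists x', (subst1 c (Var C x') x); split=> //.
  by apply: eqT_MU3 => //; rewrite inE negb_and x'c orbT.
by apply: (size_subst C).1 => y; rewrite updE; case: eqP.
Qed.

Lemma realizes_fv (T : graph C) c z : unrooted_tree T -> realizes T c ->
  z \in fvC c <-> fv T z.
Proof.
by move=> tree [d rd cd]; have [_ _ ->] := eqC_lin cd; case: (reads_lin tree rd).
Qed.

Section Induction.
Variable n : nat.
Hypothesis IH : forall e : command C, sizeC e < n -> linC e -> presentable e.

Lemma presentable_cut_var x (c : command C) v : sizeC c < n ->
  linC (Cut (Mu x c) (Var C v)) -> presentable (Cut (Mu x c) (Var C v)).
Proof.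
move=> cn l; have eq1 := eqC_MU2 V_infinite l; have [_ l1 _] := eqC_lin eq1.
apply: presentable_eq eq1 (IH _ l1); rewrite (size_subst C).1//.
by move=> y; rewrite updE; case: eqP.
Qed.

Lemma presentable_cut x (c : command C) y d : sizeC c < n -> sizeC d < n ->
  linC (Cut (Mu x c) (Mu y d)) -> presentable (Cut (Mu x c) (Mu y d)).
Proof.
move=> cn dn l A; have [[lc xc] [ld yd] dcd] := l.
(* The two bound variables become the halves of the new edge, so they must avoid [A]; they must also
   differ from each other and from the legs of the opposite tree. *)
have [x1 [c1 [x1A cc1 sc1]]] := eqT_fresh (A `|` fvT (Mu y d)) lc xc.
have [y1 [d1 [y1A dd1 sd1]]] := eqT_fresh (A `|` (x1 |` fvC c1)) ld yd.
rewrite -{}sc1 in cn; rewrite -{}sd1 in dn.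
have eq1 := eqC_cut cc1 dd1 dcd.
have [_ _ fvd1] := eqT_lin dd1; rewrite {}fvd1 in x1A.
have [_ l1 _] := eqC_lin eq1; have [[lc1 x1c1] [ld1 y1d1] /fdisjointE dcd1] := l1.
suff [T [tT bT [e re eq2]]] : exists T : graph C, [/\ unrooted_tree T,
    forall x, vars T x -> inv T x <> x -> x \notin A &
    realizes T (Cut (Mu x1 c1) (Mu y1 d1))].
  by exists T; split=> //; exists e => //; apply: eqC_trans eq1 eq2.
(* The edges of [T1] avoid the legs of [T2], and the edges of [T2] avoid everything in [T1]. Shared
   legs are excluded by linearity and the choice of [x1] and [y1]. *)
have [T1 [tree1 bT1 r1]] := IH cn lc1 (A `|` fvC d1).
have [D DP] := vars_finite T1.
have [T2 [tree2 bT2 r2]] := IH dn ld1 (A `|` D).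
case: (pselect (ordinary_tree T1)) => [otree1|ntree1]; last first.
  have [v lv eq2] := wire_absorb r1 tree1 ntree1 l1.
  exact: (presentable_eq eq2 (presentable_cut_var dn lv)).
case: (pselect (ordinary_tree T2)) => [otree2|ntree2]; last first.
  have eq2 := eqC_MU1 l1; have [_ l2 _] := eqC_lin eq2.
  have [v lv eq3] := wire_absorb r2 tree2 ntree2 l2.
  exact: (presentable_eq (eqC_trans eq2 eq3) (presentable_cut_var cn lv)).
have dis z : vars T1 z -> vars T2 z -> False.
  move=> z1 z2.
  have iz2 : inv T2 z = z.
    by apply: contrapT => /(bT2 z z2); rewrite inE (DP z).1 ?orbT.
  have zd1 : z \in fvC d1 by apply/(realizes_fv z tree2 r2).
  have iz1 : inv T1 z = z.
    by apply: contrapT => /(bT1 z z1); rewrite inE zd1 orbT.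
  have zc1 : z \in fvC c1 by apply/(realizes_fv z tree1 r1).
  have zy1 : z != y1.
    by apply: contraNneq y1A => <-; rewrite !inE zc1 !orbT.
  have zx1 : z != x1.
    by apply: contraNneq x1A => <-; rewrite !inE zy1 zd1 orbT.
  by apply: (dcd1 z); rewrite !inE ?zx1 ?zy1.
have [x1T ix1] := (realizes_fv x1 tree1 r1).1 x1c1.
have [y1T iy1] := (realizes_fv y1 tree2 r2).1 y1d1.
exists (graft dis x1T ix1 y1T iy1); split; last exact: graft_realizes.
  by left; apply: graft_tree.
move: x1A y1A; rewrite !inE !negb_or => /andP[x1A _] /andP[y1A _] z zT iz.
case: (pselect (z = x1)) => [-> //|zx1]; case: (pselect (z = y1)) => [-> //|zy1].
case: zT => K [] TK zK.
  have z1 : vars T1 z by exists K.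
  rewrite /= (graft_inv1 dis y1T z1 zx1) in iz.
  by have := bT1 z z1 iz; rewrite inE negb_or => /andP[].
have z2 : vars T2 z by exists K.
rewrite /= (graft_inv2 dis x1T z2 zy1) in iz.
by have := bT2 z z2 iz; rewrite inE negb_or => /andP[].
Qed.

End Induction.

Lemma size_setf (X : {fset V}) (a : C X) (t : X -> term C) x z :
  0 < sizeT (t x) -> sizeC (Op a (setf t x (Var C z))) < sizeC (Op a t).
Proof.
move=> tx; rewrite /= ltnS (bigD1 x)//= [in X in _ < X](bigD1 x)//= setf_eq /= add0n.
under eq_bigr => y yx do rewrite setf_neq//.
by rewrite -[X in X < _]add0n ltn_add2r.
Qed.

Lemma size_arg (X : {fset V}) (a : C X) (t : X -> term C) x :
  sizeT (t x) < sizeC (Op a t).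
Proof. by rewrite /= ltnS (bigD1 x)//= leq_addr. Qed.

(** An operation with some argument that is a binder becomes, by plugging, a cut of two strictly
    smaller commands: one loses that argument to a variable, the other is its body. What remains are
    wires, corollas applied to variables, and cuts with a binder. *)
Lemma lin_presentable (c : command C) : linC c -> presentable c.
Proof.
have [n] := ubnP (sizeC c); elim: n c => // n IH [s t|X a t] cn l.
  case: s t cn l => [x|x c] [y|y d] cn l.
  - by apply: presentable_wire; case: l => _ _; rewrite /= fdisjoint1X inE.
  - have eq1 := eqC_MU1 l; have [_ l1 _] := eqC_lin eq1.
    by apply: presentable_eq eq1 (presentable_cut_var IH _ l1); move: cn => /=; lia.
  - by apply: (presentable_cut_var IH) => //; move: cn => /=; lia.
  - by apply: (presentable_cut IH) => //; move: cn => /=; lia.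
case: (pselect (forall x, exists v, t x = Var C v)) => [/choice[g gP]|nvar].
  exact: presentable_corolla gP l.
have [x [w [d tx]]] : exists x w d, t x = Mu w d.
  apply: contrapT => nmu; apply: nvar => x; case tx : (t x) => [v|w d].
    by exists v.
  by case: nmu; exists x, w, d.
have [z zl] := exists_fresh V_infinite (fvC (Op a t)).
have eq1 : eqC (Op a t) (Cut (Mu z (Op a (setf t x (Var C z)))) (t x)).
  apply: eqC_plug => // y _; apply: contraNN zl => zy.
  by apply/in_bigU; exists y.
have [_ l1 _] := eqC_lin eq1.
apply: presentable_eq eq1 _; rewrite tx in l1 *.
apply: (presentable_cut IH) => //.
  have s1 : sizeC (Op a (setf t x (Var C z))) < sizeC (Op a t).
    by apply: size_setf; rewrite tx.
  exact: leq_trans s1 cn.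
have := size_arg a t x; rewrite tx => /= dn.
by move: cn dn => /=; lia.
Qed.

End Presentable.

(** Classes are sets, so a relation acts on them by direct and inverse image, and no representative
    has to be chosen. The third hypothesis gives both well-definedness and injectivity. *)
Lemma quotient_bijective (S T : Type) (eS : S -> S -> Prop) (eT : T -> T -> Prop)
    (rel : S -> T -> Prop) :
  (forall s, exists t, rel s t) -> (forall t, exists s, rel s t) ->
  (forall s s' t t', rel s t -> rel s' t' -> eS s s' <-> eT t t') ->
  exists Phi : quotient eS -> quotient eT, bijective Phi.
Proof.
move=> ST TS relE.
pose img (A : set S) : set T := [set t | exists2 s, A s & rel s t]%classic.
pose pre (B : set T) : set S := [set s | exists2 t, B t & rel s t]%classic.
have imgE s t : rel s t -> img [set s' | eS s s']%classic = [set t' | eT t t']%classic.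
  move=> st; apply/seteqP; split=> t' /=; first by case=> s' ss' st'; apply/(relE s s').
  by move=> tt'; have [s' st'] := TS t'; exists s' => //; apply/(relE _ _ _ _ st st').
have preE s t : rel s t -> pre [set t' | eT t t']%classic = [set s' | eS s s']%classic.
  move=> st; apply/seteqP; split=> s' /=; first by case=> t' tt' st'; apply/(relE _ _ t t').
  by move=> ss'; have [t' st'] := ST s'; exists t' => //; apply/(relE _ _ _ _ st st').
have imgP (A : quotient eS) : exists t, img (sval A) = [set t' | eT t t']%classic.
  by case: A => A /= [s ->]; have [t st] := ST s; exists t; apply: imgE.
have preP (B : quotient eT) : exists s, pre (sval B) = [set s' | eS s s']%classic.
  by case: B => B /= [t ->]; have [s st] := TS t; exists s; apply: preE st.
exists (fun A => exist _ (img (sval A)) (imgP A)).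
exists (fun B => exist _ (pre (sval B)) (preP B)).
  case=> A AP; apply: eq_exist => /=; case: AP => s ->.
  by have [t st] := ST s; rewrite (imgE _ _ st) (preE _ _ st).
case=> B BP; apply: eq_exist => /=; case: BP => t ->.
by have [s st] := TS t; rewrite (preE _ _ st) (imgE _ _ st).
Qed.

Theorem theorem3 (V : choiceType) (V_infinite : infinite_set [set: V]%classic)
    (C : bijFunctor V) (X : {fset V}) :
  exists Phi : quotient (@mu_eq V C X) -> quotient (@alpha V C X),
    bijective Phi.
Proof.
apply: (@quotient_bijective _ _ _ _
  (fun (c : muComm C X) (T : utree C X) => realizes (sval T) (sval c))).
- case=> c /typCP[XE lc] /=.
  (* The set of avoided names matters only in the induction, so it is taken empty here. *)
  have [T [tree _ r]] := lin_presentable V_infinite lc fset0.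
  have fvE : fv T = [set x | x \in X]%classic.
    apply/seteqP; split=> x; first by move/(realizes_fv x tree r); rewrite XE.
    by rewrite /= XE => /(realizes_fv x tree r).
  by exists (exist _ T (conj tree fvE)).
- case=> T [tree fvE]; have [c rc] := reads_exist tree.
  have [lc cfv] := reads_lin tree rc.
  have cX : typC X c.
    apply/typCP; split=> //; apply/fsetP => x; apply/idP/idP.
      by move=> xX; apply/cfv; rewrite fvE.
    by move/cfv; rewrite fvE.
  by exists (exist _ c cX), c => //; apply: eqC_refl.
(* Equal commands give alpha-equivalent trees through the model. Conversely, alpha-equivalence lets
   [T'] realize [c] too, and all readings of [T'] are equal. *)
case=> c cX [c' cX'] [T [tree fvE]] [T' [tree' fvE']] /= r r'; split.
  move=> /eqCP[_ cc']; case: r r' => [d rd cd] [d' rd' cd'].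
  apply: (reads_alpha V_infinite tree tree' rd rd').
  exact: eqC_trans (eqC_sym cd) (eqC_trans cc' cd').
move=> TT'; have [e re ce] := (realizes_alpha V_infinite c TT').1 r.
case: r' => [d' rd' cd']; apply/eqCP; split; first by have [] := (typCP X c).1 cX.
exact: eqC_trans ce (eqC_trans (reads_eq V_infinite tree' re rd') (eqC_sym cd')).
Qed.
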